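(* Let $f:\mathbb{R}^n\to\mathbb{R}^n$ be a Lipschitz mapping such that $\partial f(x)$ has maximal rank for all $x\in\mathbb{R}^n$, and suppose that $$\operatorname{Spec}(\partial f(x))\subset\{z\in\mathbb{C}:\operatorname{Re}(z)<0\}\quad\text{for all }x\in\mathbb{R}^n.$$ Then $f$ is injective.
   Context: For a Lipschitz mapping $f:\mathbb{R}^n\to\mathbb{R}^n$, the Clarke generalized differential $\partial f(x)$ is the convex hull of all limits $\lim_i df(x_i)$ with $x_i\to x$ and $f$ differentiable at each $x_i$, where $df(x_i)$ is identified with the Jacobian matrix. $\partial f(x)$ has maximal rank if every matrix in $\partial f(x)$ is invertible. $\operatorname{Spec}(\partial f(x))$ denotes the set of all complex eigenvalues of all matrices $A\in\partial f(x)$. *)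

(* Defs.v *)
From mathcomp Require Import all_boot all_order all_algebra.
From mathcomp Require Import complex.
From mathcomp Require Import all_classical all_reals all_analysis.

Set Implicit Arguments.
Unset Strict Implicit.
Unset Printing Implicit Defensive.

Import Order.TTheory GRing.Theory Num.Theory.
Import numFieldNormedType.Exports.

Local Open Scope classical_set_scope.
Local Open Scope ring_scope.

(* Vectors are rows: ['J f x] is the matrix J with ['d f x v = v *m J], i.e.
   the transpose of the matrix of partial derivatives acting on columns.  This
   is the convention of [eigenvalue], which is about [v *m A = a *: v]. *)
Definition limiting_jacobian (R : realType) (n : nat)
    (f : 'rV[R]_n -> 'rV[R]_n) (x : 'rV[R]_n) : set 'M[R]_n :=
  [set A | exists u : nat -> 'rV[R]_n,
     [/\ u @ \oo --> x,
         forall i, differentiable f (u i)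
       & (fun i => 'J f (u i)) @ \oo --> A]].

Definition convex_hull (R : realType) (M : lmodType R) (S : set M) : set M :=
  smallest (@convex_set R M) S.

Definition clarke_differential (R : realType) (n : nat)
    (f : 'rV[R]_n -> 'rV[R]_n) (x : 'rV[R]_n) : set 'M[R]_n :=
  convex_hull (limiting_jacobian f x).

Definition maximal_rank (R : realType) (n : nat) (D : set 'M[R]_n) : Prop :=
  forall A, D A -> A \in unitmx.

Definition spectrum (R : realType) (n : nat) (D : set 'M[R]_n) : set R[i] :=
  [set z | exists2 A, D A & eigenvalue (map_mx (real_complex R) A) z].

(* Main.v *)
Require Import Defs.
From mathcomp Require Import all_boot all_order all_algebra.
From mathcomp Require Import complex.
From mathcomp Require Import all_classical all_reals all_analysis.
From mathcomp Require Import perm ring lra.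

(* Write f_t = f - t id.  For t > 0 the matrices A - t, with A in the Clarke
   differential at any point, have determinant at least t^n in absolute value
   and bounded entries, so their inverses are bounded uniformly in A and x.
   By the mean value inequality for Lipschitz maps, f_t then expands distances
   near every point by a factor locally uniform in t.  For large t the map f_t
   is invertible by the contraction principle; a Lipschitz inverse of f_t
   persists when t decreases a little, and the local expansion bounds its
   Lipschitz constant independently of the steps, so f_t is bijective for all
   t > 0.  At t = 0 the Clarke differential is a compact set of invertible
   matrices, so f expands distances near each x, and the unique solution of
   f_t(u) = f(x) tends to x as t -> 0.  Hence f(x) = f(y) forces x = y.

   The mean value inequality needs a point where f is differentiable and its
   derivative satisfies a given linear inequality.  The mean gradient of f over
   a cube is a bounded martingale along dyadic subdivision, and its energy
   converges.  A Chebyshev argument yields nested cubes whose surroundings, at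
   all scales, have mean gradient close to a common limit; f is differentiable
   at their intersection. *)

Set Implicit Arguments.
Unset Strict Implicit.
Unset Printing Implicit Defensive.

Import Order.TTheory GRing.Theory Num.Theory.
Import numFieldNormedType.Exports.

Local Open Scope classical_set_scope.
Local Open Scope ring_scope.

(** * Averages over dyadic cubes *)

Section DyadicCubes.
Variables (R : realType) (n : nat).

(** Dyadic averages stand in for integration: a mean gradient is a difference of face means, so a
    Lipschitz function has one on every cube before any differentiability is known. A segment may
    miss every point of differentiability; hence the mean value inequality searches small cubes
    placed along the segment, and its hypothesis is required on a whole ball.

    The shift by t is there because the spectral condition gives no uniform bound at t = 0: nothing
    keeps an eigenvalue z away from 0 as x runs to infinity, whereas |t - z| >= t whenever Re z < 0.
    Continuation therefore works on each half-line from some t > 0, and t = 0 is reached by a limit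
    in which bounds near two given points suffice.

    Invertibility of each single matrix would not give local expansion: one vector p has to separate
    0 from the vectors v A for all A at once, and this is where convexity of the Clarke differential
    enters. *)

Definition side (j : nat) : R := 2^-1 ^+ j.

Definition cube : Type := (nat * 'rV[R]_n)%type.

Definition bitv (s : {ffun 'I_n -> bool}) : 'rV[R]_n := \row_i (s i)%:R.

Definition child (Q : cube) (s : {ffun 'I_n -> bool}) : cube :=
  (Q.1.+1, Q.2 + side Q.1.+1 *: bitv s).

Fixpoint descendant (d : nat) (Q P : cube) : Prop :=
  if d is d'.+1 then exists s, descendant d' (child Q s) P else P = Q.

Definition avg (phi : {ffun 'I_n -> bool} -> R) : R := (2 ^+ n)^-1 * \sum_s phi s.

Fixpoint level_avg (d : nat) (phi : cube -> R) (Q : cube) : R :=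
  if d is d'.+1 then avg (fun s => level_avg d' phi (child Q s)) else phi Q.

Lemma side_gt0 j : 0 < side j.
Proof. by rewrite exprn_gt0. Qed.

Lemma sideS j : side j = side j.+1 + side j.+1.
Proof. by rewrite /side exprS; lra. Qed.

Lemma sideD i j : side (i + j) = side i * side j.
Proof. exact: exprD. Qed.

Lemma side_le i j : (i <= j)%N -> side j <= side i.
Proof. by move=> ij; rewrite /side ler_wiXn2l//; lra. Qed.

Lemma avg_le (phi psi : {ffun 'I_n -> bool} -> R) :
  (forall s, phi s <= psi s) -> avg phi <= avg psi.
Proof.
move=> h; rewrite /avg ler_wpM2l ?invr_ge0 ?exprn_ge0 //.
by apply: ler_sum => s _.
Qed.

Lemma eq_avg (phi psi : {ffun 'I_n -> bool} -> R) : phi =1 psi -> avg phi = avg psi.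
Proof. by move=> h; rewrite /avg (eq_bigr _ (fun s _ => h s)). Qed.

Lemma avg_cst c : avg (fun=> c) = c.
Proof.
rewrite /avg sumr_const card_ffun card_bool card_ord -[c *+ _]mulr_natl natrX mulKf// expf_neq0.
Qed.

Lemma avgD phi psi : avg (fun s => phi s + psi s) = avg phi + avg psi.
Proof. by rewrite /avg big_split mulrDr. Qed.

Lemma avgZ c phi : avg (fun s => c * phi s) = c * avg phi.
Proof. by rewrite /avg -mulr_sumr mulrCA. Qed.

Lemma avg_sum (K : finType) (phi : K -> {ffun 'I_n -> bool} -> R) :
  avg (fun s => \sum_k phi k s) = \sum_k avg (phi k).
Proof. by rewrite /avg exchange_big /= mulr_sumr. Qed.

Lemma avg_ge (phi : {ffun 'I_n -> bool} -> R) s :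
  (forall s, 0 <= phi s) -> (2 ^+ n)^-1 * phi s <= avg phi.
Proof.
move=> h; rewrite /avg ler_wpM2l ?invr_ge0 ?exprn_ge0 //.
by rewrite (bigD1 s) //= lerDl sumr_ge0.
Qed.

(** Variance identity: the mean square about [c] is the mean square about the mean [m] plus
    [(m - c) ^+ 2]. *)
Lemma avg_sq (phi : {ffun 'I_n -> bool} -> R) c :
  (avg phi - c) ^+ 2 <= avg (fun s => (phi s - c) ^+ 2).
Proof.
set m := avg phi.
have -> : avg (fun s => (phi s - c) ^+ 2) =
  avg (fun s => (phi s - m) ^+ 2) + (m - c) ^+ 2.
  transitivity (avg (fun s => (phi s - m) ^+ 2 + (2 * (m - c)) * phi s
      + ((m - c) ^+ 2 - 2 * (m - c) * m))).
    by apply: eq_avg => s; ring.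
  by rewrite avgD avgD avgZ avg_cst -/m; ring.
rewrite lerDr -(avg_cst 0); apply: avg_le => s; exact: sqr_ge0.
Qed.

Lemma level_avg_le d (phi psi : cube -> R) Q :
  (forall P, descendant d Q P -> phi P <= psi P) -> level_avg d phi Q <= level_avg d psi Q.
Proof.
elim: d Q => [|d IH] Q h /=; first exact: h.
by apply: avg_le => s; apply: IH => P hP; apply: h; exists s.
Qed.

Lemma eq_level_avg d (phi psi : cube -> R) Q : phi =1 psi -> level_avg d phi Q = level_avg d psi Q.
Proof. by move=> h; elim: d Q => //= d IH Q; apply: eq_avg => s. Qed.

Lemma level_avg_cst d c Q : level_avg d (fun=> c) Q = c.
Proof. by elim: d Q => //= d IH Q; rewrite (eq_avg (fun s => IH _)) avg_cst. Qed.

Lemma level_avgD d phi psi Q : level_avg d (fun P => phi P + psi P) Q =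
  level_avg d phi Q + level_avg d psi Q.
Proof.
by elim: d Q => //= d IH Q; rewrite (eq_avg (fun s => IH _)) avgD.
Qed.

Lemma level_avgZ d c phi Q : level_avg d (fun P => c * phi P) Q = c * level_avg d phi Q.
Proof. by elim: d Q => //= d IH Q; rewrite (eq_avg (fun s => IH _)) avgZ. Qed.

Lemma level_avg_sum d (K : finType) (phi : K -> cube -> R) Q :
  level_avg d (fun P => \sum_k phi k P) Q = \sum_k level_avg d (phi k) Q.
Proof.
by elim: d Q => //= d IH Q; rewrite (eq_avg (fun s => IH _)) avg_sum.
Qed.

Lemma level_avg_ge0 d phi Q : (forall P, 0 <= phi P) -> 0 <= level_avg d phi Q.
Proof. by move=> h; rewrite -(level_avg_cst d 0 Q); apply: level_avg_le => P _. Qed.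

Lemma level_avg_add d e phi Q : level_avg (d + e) phi Q = level_avg d (level_avg e phi) Q.
Proof. by elim: d Q => //= d IH Q; apply: eq_avg => s. Qed.

Lemma level_avg_martingale d phi Q :
  (forall P, phi P = avg (fun s => phi (child P s))) -> level_avg d phi Q = phi Q.
Proof.
by move=> h; elim: d Q => //= d IH Q; rewrite h; apply: eq_avg => s.
Qed.

Lemma level_avg_submartingale d phi Q :
  (forall P, phi P <= avg (fun s => phi (child P s))) -> phi Q <= level_avg d phi Q.
Proof.
move=> h; elim: d Q => //= d IH Q; apply: le_trans (h _) _; exact: avg_le.
Qed.

Lemma descendant_level d Q P : descendant d Q P -> P.1 = (Q.1 + d)%N.
Proof.
elim: d Q => [|d IH] Q /=; first by move=> ->; rewrite addn0.
by move=> [s /IH ->]; rewrite addnS addSn.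
Qed.

Lemma descendant_box d Q P : descendant d Q P -> forall i,
  Q.2 0 i <= P.2 0 i /\ P.2 0 i + side P.1 <= Q.2 0 i + side Q.1.
Proof.
elim: d Q => [|d IH] Q /=; first by move=> -> i; split.
move=> [s /IH h] i; move: (h i); rewrite /= !mxE (sideS Q.1).
have := side_gt0 Q.1.+1; case: (s i) => /=; lra.
Qed.

(* Reads off the binary digits of the index [z]. *)
Lemma descendant_grid d Q (z : 'I_n -> nat) : (forall i, (z i < 2 ^ d)%N) ->
  descendant d Q ((Q.1 + d)%N, Q.2 + side (Q.1 + d) *: \row_i (z i)%:R).
Proof.
elim: d Q z => [|d IH] Q z hz /=.
  rewrite addn0 (_ : \row_i _ = 0) ?scaler0 ?addr0; first by case: Q.
  by apply/rowP => i; rewrite !mxE; have := hz i; rewrite expn0 ltnS leqn0 => /eqP ->.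
pose s : {ffun 'I_n -> bool} := [ffun i => (2 ^ d <= z i)%N].
exists s.
have := IH (child Q s) (fun i => (z i - s i * 2 ^ d)%N); rewrite /= addSnnS.
have -> : Q.2 + side Q.1.+1 *: bitv s +
  side (Q.1 + d.+1) *: \row_i ((z i - s i * 2 ^ d)%N)%:R =
  Q.2 + side (Q.1 + d.+1) *: \row_i (z i)%:R.
  apply/rowP => i; rewrite !mxE ffunE -addrA; congr (_ + _).
  have : (z i < 2 ^ d.+1)%N by exact: hz.
  case: (leqP (2 ^ d)%N (z i)) => h _ /=; last by rewrite ?mul0n ?subn0 mulr0 add0r.
  rewrite ?mul1n natrB // mulrBr addrC mulr1 -addrA natrX -addSnnS sideD -[RHS]addr0.
  congr (_ + _); rewrite -mulrA -exprMn mulVf ?expr1n; last by [].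
  by rewrite mulr1 addNr.
apply; move=> i; rewrite ffunE; have := hz i; rewrite expnS mul2n -addnn.
by case: (leqP (2 ^ d)%N (z i)) => h /=; rewrite ?mul1n ?mul0n ?subn0 // ltn_subLR.
Qed.

(** A sup-norm ball of radius [W] sides about the lower corner of [D]; boolean, so that its
    indicator can be averaged. *)
Definition enlarged (W : nat) (D : cube) (x : 'rV[R]_n) : bool :=
  [forall i, `|x 0 i - D.2 0 i| <= W%:R * side D.1].

Lemma enlarged_child W D s x : (0 < W)%N -> enlarged W (child D s) x -> enlarged W D x.
Proof.
move=> W0 /forallP h; apply/forallP => i; have := h i; rewrite /= !mxE.
have : (1 : R) <= W%:R by rewrite ler1n.
rewrite (sideS D.1); have := side_gt0 D.1.+1; set t := side _.
rewrite !ler_distl; case: (s i) => /= t0 W1; nra.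
Qed.

(** For b <= c, the increment of [clamp b c] over an interval is the length of its intersection with
    [b, c]; this length is then additive under bisection without case analysis. *)
Definition clamp (b c x : R) := Num.max b (Num.min x c).

Lemma clamp_mono b c x y : x <= y -> clamp b c x <= clamp b c y.
Proof.
move=> xy; have h : Num.min x c <= Num.min y c by rewrite le_min !ge_min xy lexx orbT.
by rewrite /clamp ge_max !le_max lexx h orbT.
Qed.

Lemma clamp_width b c x y : b <= c -> clamp b c y - clamp b c x <= c - b.
Proof.
move=> bc; apply: lerB; last by rewrite /clamp le_max lexx.
by rewrite /clamp ge_max bc ge_min lexx orbT.
Qed.

Lemma clamp_id b c x : b <= x -> x <= c -> clamp b c x = x.
Proof. by move=> bx xc; rewrite /clamp min_l // max_r. Qed.

(* The volume of the intersection of [Q] with the box [b, c]. *)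
Definition boxvol (b c : 'rV[R]_n) (Q : cube) : R :=
  \prod_i (clamp (b 0 i) (c 0 i) (Q.2 0 i + side Q.1) -
           clamp (b 0 i) (c 0 i) (Q.2 0 i)).

Lemma boxvol_child b c Q :
  avg (fun s => boxvol b c (child Q s)) = (2 ^+ n)^-1 * boxvol b c Q.
Proof.
rewrite /avg; congr (_ * _); rewrite /boxvol.
pose G i (e : bool) := clamp (b 0 i) (c 0 i) (Q.2 0 i + side Q.1.+1 * e%:R + side Q.1.+1)
   - clamp (b 0 i) (c 0 i) (Q.2 0 i + side Q.1.+1 * e%:R).
transitivity (\sum_(s : {ffun 'I_n -> bool}) \prod_i G i (s i)).
  by apply: eq_bigr => s _; apply: eq_bigr => i _; rewrite /G /= !mxE.
rewrite -bigA_distr_bigA; apply: eq_bigr => i _.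
rewrite big_bool /G /= mulr1 mulr0 addr0 (sideS Q.1) (addrA (Q.2 0 i)); lra.
Qed.


Lemma level_avg_boxvol d b c Q : level_avg d (boxvol b c) Q = ((2 ^+ n)^-1) ^+ d * boxvol b c Q.
Proof.
elim: d Q => [|d IH] Q /=; first by rewrite expr0 mul1r.
by rewrite (eq_avg (fun s => IH _)) avgZ boxvol_child mulrA exprSr.
Qed.

Lemma side_expn d : side d ^+ n = ((2 ^+ n)^-1) ^+ d.
Proof. by rewrite -[in RHS]exprVn exprAC. Qed.

(** Volume count: the subcubes of side [eps] with corner in the enlargement of [C] fill part of the
    box [b, c], and [boxvol] averages exactly. Since [C] may be [e] levels finer than these
    subcubes, [eps] can be as large as [2 ^+ e * side C.1], whence the summand [2 ^+ e]. *)
Lemma level_avg_enlarged (W N e : nat) (Q C : cube) : (C.1 <= Q.1 + N + e)%N ->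
  level_avg N (fun P => (enlarged W C P.2)%:R) Q <=
  (2 * W%:R + 2 ^+ e) ^+ n * (side C.1 / side Q.1) ^+ n.
Proof.
move=> hC; set eps := side (Q.1 + N).
have eps0 : 0 < eps by exact: side_gt0.
pose b : 'rV[R]_n := \row_i (C.2 0 i - W%:R * side C.1).
pose c : 'rV[R]_n := \row_i (C.2 0 i + W%:R * side C.1 + eps).
have w0 : 0 <= W%:R * side C.1 by rewrite mulr_ge0 // ltW // side_gt0.
have bc i : b 0 i <= c 0 i by rewrite !mxE; lra.
have epsle : eps <= 2 ^+ e * side C.1.
  rewrite -ler_pdivrMl ?exprn_gt0// -exprVn -/(side e) mulrC -sideD.
  exact: side_le.
have box0 P : 0 <= boxvol b c P.
  apply: prodr_ge0 => i _; rewrite subr_ge0 clamp_mono // lerDl ltW //.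
  exact: side_gt0.
have box_le : boxvol b c Q <= ((2 * W%:R + 2 ^+ e) * side C.1) ^+ n.
  rewrite -[n in _ ^+ n](card_ord n) -prodr_const; apply: ler_prod => i _.
  apply/andP; split.
    by rewrite subr_ge0 clamp_mono // lerDl ltW // side_gt0.
  apply: le_trans (clamp_width _ _ (bc i)) _; rewrite !mxE; nra.
apply: (@le_trans _ _ (level_avg N (fun P => (eps ^+ n)^-1 * boxvol b c P) Q)).
  apply: level_avg_le => P hP; case: (boolP (enlarged _ _ _)) => [/forallP hx|_] /=; last first.
    by rewrite mulr_ge0 ?invr_ge0 ?exprn_ge0 // ltW.
  rewrite (_ : boxvol b c P = eps ^+ n) ?mulVf ?gt_eqF ?exprn_gt0 //.
  rewrite /boxvol (descendant_level hP) -/eps -[n in _ ^+ n](card_ord n) -prodr_const.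
  apply: eq_bigr => i _; have := hx i; rewrite ler_distl => /andP[h1 h2].
  by rewrite !clamp_id ?mxE; lra.
rewrite level_avgZ level_avg_boxvol mulrA -side_expn -exprVn -exprMn.
have -> : eps^-1 * side N = (side Q.1)^-1.
  rewrite /eps sideD invfM -mulrA mulVf ?mulr1 // gt_eqF //; exact: side_gt0.
apply: (le_trans (ler_wpM2l _ box_le)); first by rewrite exprn_ge0 // invr_ge0 ltW // side_gt0.
by rewrite -!exprMn mulrCA (mulrC _^-1).
Qed.

End DyadicCubes.

(** * Bounded martingales on dyadic cubes *)

Section CubeMartingale.
Variables (R : realType) (n : nat) (K : finType) (M : K -> cube R n -> R) (L : R).
Hypothesis M_avg : forall k Q, M k Q = avg (fun s => M k (child Q s)).
Hypothesis M_bounded : forall k Q, `|M k Q| <= L.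

Lemma level_avg_exists_lt d (phi : cube R n -> R) Q c :
  level_avg d phi Q < c -> exists2 P, descendant d Q P & phi P < c.
Proof.
move=> h; apply: contrapT => hn; move: h; rewrite ltNge => /negP; apply.
rewrite -(level_avg_cst d c Q); apply: level_avg_le => P hP; rewrite leNgt; apply/negP => hc.
by apply: hn; exists P.
Qed.

Definition sq_dist (A : K -> R) (Q : cube R n) : R := \sum_k (M k Q - A k) ^+ 2.

Definition energy (d : nat) (Q : cube R n) : R := level_avg d (sq_dist (fun=> 0)) Q.

Definition energy_lim (Q : cube R n) : R := limn (energy ^~ Q).

(* Mean square oscillation of [M] inside [Q] over all finer scales. *)
Definition dispersion (Q : cube R n) : R := energy_lim Q - sq_dist (fun=> 0) Q.

Lemma sq_dist_submartingale A Q : sq_dist A Q <= avg (fun s => sq_dist A (child Q s)).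
Proof.
rewrite /sq_dist avg_sum; apply: ler_sum => k _; rewrite M_avg; exact: avg_sq.
Qed.

Lemma energyS d Q : energy d Q <= energy d.+1 Q.
Proof.
rewrite /energy -addn1 level_avg_add; apply: level_avg_le => P _ /=; exact: sq_dist_submartingale.
Qed.

Lemma energy_nondecreasing Q : nondecreasing_seq (energy ^~ Q).
Proof. by apply/nondecreasing_seqP => d; exact: energyS. Qed.

Lemma energy_bounded d Q : energy d Q <= #|K|%:R * L ^+ 2.
Proof.
rewrite -(level_avg_cst d (_ * _) Q); apply: level_avg_le => P _; rewrite /sq_dist.
rewrite mulr_natl -sumr_const; apply: ler_sum => k _; rewrite subr0.
by rewrite -(real_normK (num_real _)) lerXn2r ?nnegrE // (le_trans _ (M_bounded k P)).
Qed.

Lemma energy_cvg Q : energy ^~ Q @ \oo --> energy_lim Q.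
Proof.
apply: nondecreasing_is_cvgn; first exact: energy_nondecreasing.
by exists (#|K|%:R * L ^+ 2) => _ [d _ <-]; exact: energy_bounded.
Qed.

Lemma energy_le_lim d Q : energy d Q <= energy_lim Q.
Proof.
apply: nondecreasing_cvgn_le; first exact: energy_nondecreasing.
by apply/cvg_ex; exists (energy_lim Q); exact: energy_cvg.
Qed.

Lemma energy_lim_avg Q : energy_lim Q = avg (fun s => energy_lim (child Q s)).
Proof.
have h1 : (fun d => energy d.+1 Q) @ \oo --> energy_lim Q.
  by rewrite (cvg_shiftS (energy ^~ Q)); exact: energy_cvg.
have h2 : (fun d => energy d.+1 Q) @ \oo --> avg (fun s => energy_lim (child Q s)).
  rewrite /energy /= /avg; apply: cvgMl_tmp.
  apply: cvg_big => //= [|s _]; [exact: add_continuous|exact: energy_cvg].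
exact: (cvg_unique _ h1 h2).
Qed.

Lemma dispersion_ge0 Q : 0 <= dispersion Q.
Proof. by rewrite subr_ge0; exact: (energy_le_lim 0). Qed.

Lemma level_avg_dispersion d Q : level_avg d dispersion Q = energy_lim Q - energy d Q.
Proof.
rewrite /dispersion (@eq_level_avg _ _ d _ (fun P => energy_lim P + (-1) * sq_dist (fun=> 0) P)).
  by rewrite level_avgD level_avgZ mulN1r (level_avg_martingale _ _ energy_lim_avg).
by move=> P; rewrite mulN1r.
Qed.

Lemma level_avg_dispersion_small Q eps : 0 < eps -> exists N, forall d, (N <= d)%N ->
  level_avg d dispersion Q <= eps.
Proof.
move=> eps0; have /cvgrPdist_le /(_ _ eps0) [N _ hN] := @energy_cvg Q.
exists N => d Nd; rewrite level_avg_dispersion; apply: le_trans (ler_norm _) _; exact: hN.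
Qed.

(** Orthogonality of martingale increments: the cross term averages to the square at [Q], so the
    left side is [energy d Q] minus the energy of [Q] itself. *)
Lemma level_avg_sq_dist d Q : level_avg d (sq_dist (M^~ Q)) Q <= dispersion Q.
Proof.
rewrite /dispersion (@eq_level_avg _ _ d _ (fun P => sq_dist (fun=> 0) P +
  ((-2) * (\sum_k M k Q * M k P)
   + sq_dist (fun=> 0) Q))); last first.
  move=> P; rewrite /sq_dist mulr_sumr -!big_split /=; apply: eq_bigr => k _; ring.
rewrite level_avgD level_avgD level_avgZ level_avg_cst.
rewrite (@level_avg_sum _ _ d _ (fun k P => M k Q * M k P)).
rewrite (eq_bigr (fun k => M k Q ^+ 2)); last first.
  by move=> k _ /=; rewrite level_avgZ (level_avg_martingale _ _ (M_avg k)).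
rewrite (_ : \sum_k M k Q ^+ 2 = sq_dist (fun=> 0) Q); last first.
  by apply: eq_bigr => k _; rewrite subr0.
have := energy_le_lim d Q; rewrite /energy; lra.
Qed.

(** Both properties come from one average, that of [l P + k0 * dispersion P]: [l] is a martingale,
    and at large depth the dispersion term uses at most half of the gap [c - l Q]. Some [P] thus has
    a value below [c]; as [c - l P <= B], the choice [k0 = B / eta] turns this into
    [dispersion P <= eta]. *)
Lemma dispersion_descent (a : K -> R) Q c eta : 0 < eta ->
  \sum_k a k * M k Q < c ->
  exists d P, [/\ descendant d Q P, \sum_k a k * M k P < c & dispersion P <= eta].
Proof.
move=> eta0 hc; set l := fun P => \sum_k a k * M k P.
pose B := \sum_k `|a k| * L + `|c| + 1.
have L0 k : 0 <= `|a k| * L.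
  by rewrite mulr_ge0 // (le_trans _ (M_bounded k Q)).
have B0 : 0 < B.
  have : 0 <= \sum_k `|a k| * L by apply: sumr_ge0.
  by have := normr_ge0 c; rewrite /B; lra.
have hB P : c - l P <= B.
  have : `|l P| <= \sum_k `|a k| * L.
    apply: le_trans (ler_norm_sum _ _ _) _; apply: ler_sum => k _.
    by rewrite normrM ler_wpM2l.
  have := ler_norm c; have := ler_norm (- l P); rewrite normrN /B; lra.
pose k0 := B / eta.
have k00 : 0 < k0 by rewrite divr_gt0.
have cl : 0 < c - l Q by rewrite subr_gt0.
have [N hN] := level_avg_dispersion_small Q (divr_gt0 cl (mulr_gt0 k00 (ltr0Sn R 1))).
have hlt_avg : level_avg N (fun P => l P + k0 * dispersion P) Q < c.
  rewrite level_avgD level_avgZ (@level_avg_martingale _ _ _ l); last first.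
    move=> P; rewrite /l /= avg_sum; apply: eq_bigr => k _.
    by rewrite avgZ -M_avg.
  have := hN N (leqnn _); rewrite (ler_pdivlMr _ _ (mulr_gt0 k00 (ltr0Sn R 1))).
  by set v := level_avg _ _ _; nra.
have [P hP hlt] := level_avg_exists_lt hlt_avg.
have v0 := dispersion_ge0 P.
exists N, P; split => //.
  by apply: le_lt_trans hlt; rewrite -/(l P) lerDl mulr_ge0 // ltW.
have : k0 * dispersion P <= B by have := hB P; lra.
by rewrite /k0 mulrAC ler_pdivrMr // ler_pM2l.
Qed.

End CubeMartingale.

(** * Covering estimate for enlargements of bad cubes *)

Section Pollution.
Variables (R : realType) (n : nat) (bad : pred (cube R n)) (W : nat).
Hypothesis W_gt0 : (0 < W)%N.

(* [bad_mass d Q] is the relative volume of the maximal bad cubes of relative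
   depth at most [d] in [Q]. *)
Fixpoint bad_mass (d : nat) (Q : cube R n) : R :=
  if bad Q then 1 else
  if d is d'.+1 then avg (fun s => bad_mass d' (child Q s)) else 0.

Fixpoint polluted (d : nat) (Q : cube R n) (x : 'rV[R]_n) : bool :=
  (bad Q && enlarged W Q x) ||
  if d is d'.+1 then [exists s, polluted d' (child Q s) x] else false.

Lemma bad_mass_ge0 d Q : 0 <= bad_mass d Q.
Proof.
elim: d Q => [|d IH] Q /=; case: ifP => // _; rewrite -(avg_cst n 0).
exact: avg_le.
Qed.

(** Enlargements are nested along descent, so only maximal bad cubes matter; [W_gt0] is what makes a
    child's enlargement fit into its parent's. *)
Lemma polluted_enlarged d Q x : polluted d Q x -> enlarged W Q x.
Proof.
elim: d Q => [|d IH] Q /=; first by rewrite orbF => /andP[].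
by case/orP => [/andP[]//|/existsP[s /IH]]; exact: enlarged_child.
Qed.

Lemma polluted_intro i d Q D x : (i <= d)%N -> descendant i Q D -> bad D -> enlarged W D x ->
  polluted d Q x.
Proof.
elim: i d Q => [|i IH] [|d] Q //=.
- by move=> _ -> -> ->.
- by move=> _ -> -> ->.
move=> id [s hs] bD eD; apply/orP; right; apply/existsP; exists s.
exact: IH.
Qed.

(** Union bound over the maximal bad cubes. Passing to children divides the volume ratio by
    [2 ^+ n], which is exactly the weight of a child in [bad_mass]. *)
Lemma level_avg_polluted N e Q0 d Q : (Q.1 + d <= Q0.1 + N + e)%N ->
  level_avg N (fun P => (polluted d Q P.2)%:R) Q0 <=
  (2 * W%:R + 2 ^+ e) ^+ n * (side R Q.1 / side R Q0.1) ^+ n * bad_mass d Q.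
Proof.
elim: d Q => [|d IH] Q hd.
  rewrite /=; case: ifP => bQ /=; last by rewrite level_avg_cst mulr0.
  rewrite mulr1; under eq_level_avg do rewrite orbF.
  by apply: level_avg_enlarged; rewrite addn0 in hd.
case bQ: (bad Q).
  have -> : bad_mass d.+1 Q = 1 by rewrite /= bQ.
  rewrite mulr1; apply: le_trans (level_avg_enlarged W (N := N) (e := e) _); last first.
    by apply: leq_trans hd; rewrite leq_addr.
  apply: level_avg_le => P _.
  by have := @polluted_enlarged d.+1 Q P.2; case: (polluted d.+1 Q P.2) => [->|_].
rewrite /= bQ /=.
apply: (@le_trans _ _ (\sum_s level_avg N (fun P => (polluted d (child Q s) P.2)%:R) Q0)).
  rewrite -level_avg_sum; apply: level_avg_le => P _.
  case: existsP => [[s hs]|_]; last by apply: sumr_ge0 => s _; rewrite ler0n.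
  by rewrite (bigD1 s) //= hs lerDl; apply: sumr_ge0 => t _; rewrite ler0n.
have h s : level_avg N (fun P => (polluted d (child Q s) P.2)%:R) Q0 <=
  (2 * W%:R + 2 ^+ e) ^+ n * (side R Q.1 / side R Q0.1) ^+ n *
    ((2 ^+ n)^-1 * bad_mass d (child Q s)).
  apply: le_trans (IH _ _) _ => /=; first by rewrite addSnnS.
  rewrite -!mulrA ler_wpM2l ?exprn_ge0 ?addr_ge0 ?mulr_ge0 ?exprn_ge0 ?ler0n//.
  rewrite mulrA ler_wpM2r ?bad_mass_ge0 // -exprVn -exprMn.
  by rewrite /side exprS -mulrA mulrC.
apply: le_trans (ler_sum _ (fun s _ => h s)) _.
by rewrite -!mulr_sumr.
Qed.

End Pollution.

Section GoodCube.
Variables (R : realType) (n : nat) (K : finType) (M : K -> cube R n -> R) (L : R).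
Hypothesis M_avg : forall k Q, M k Q = avg (fun s => M k (child Q s)).
Hypothesis M_bounded : forall k Q, `|M k Q| <= L.

(** Doob's maximal inequality: the descent stops at a maximal bad cube, and since [sq_dist] is a
    submartingale its average below that cube is still larger than [lam]. *)
Lemma bad_mass_le (lam : R) A d Q : 0 < lam ->
  lam * bad_mass (fun P => lam < sq_dist M A P) d Q <= level_avg d (sq_dist M A) Q.
Proof.
move=> lam0; elim: d Q => [|d IH] Q /=.
  case: ifP => [h|_]; first by rewrite mulr1 ltW.
  by rewrite mulr0; apply: sumr_ge0 => k _; exact: sqr_ge0.
case: ifP => h; last by rewrite -avgZ; apply: avg_le => s.
rewrite mulr1; apply: le_trans (ltW h) _.
exact: (level_avg_submartingale d.+1 Q (sq_dist_submartingale M_avg A)).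
Qed.

(* By Chebyshev, most subcubes [P] in the middle of [Q] have small dispersion and
   avoid the enlargements of all bad cubes [D].  Allowing [D] to be up to [e]
   levels finer than [P] controls the surroundings of [P] at scales comparable
   to [P] itself, before the next subcube takes over. *)
Lemma good_subcube (W e : nat) (lam eta : R) Q :
  (0 < W)%N -> 0 < lam -> 0 < eta ->
  dispersion M Q * (2 * W%:R + 2 ^+ e) ^+ n * (2 * (2 ^+ n) ^+ 2) <= lam ->
  exists d P, [/\ descendant d Q P,
    forall i, Q.2 0 i + side R Q.1 / 2 <= P.2 0 i /\
              P.2 0 i + side R P.1 <= Q.2 0 i + side R Q.1 * (3 / 4),
    dispersion M P <= eta &
    forall i D, (i <= d + e)%N -> descendant i Q D -> enlarged W D P.2 ->
      sq_dist M (M^~ Q) D <= lam].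
Proof.
move=> W0 lam0 eta0 hvar; set p := (2 ^+ n) ^+ 2 : R.
have p0 : 0 < p by rewrite !exprn_gt0.
have eta4 : 0 < eta / (4 * p) by rewrite divr_gt0 // mulr_gt0.
have [N0 /(_ N0.+2 (leq_trans (leqnSn _) (leqnSn _))) hN0] :=
  level_avg_dispersion_small M_avg M_bounded Q eta4.
pose bad P := lam < sq_dist M (M^~ Q) P.
set N := N0.+2 in hN0.
(* [phi P < 1] forces both that [P] is not polluted and that its dispersion is below [eta].
   Pollution contributes at most 1/(2p) to the average of [phi] and dispersion at most 1/(4p); the
   total is less than 1/p, the weight of one grandchild of [Q]. *)
pose phi P := (polluted bad W (N + e) Q P.2)%:R + eta^-1 * dispersion M P.
have phi0 P : 0 <= phi P.
  by rewrite addr_ge0 ?ler0n // mulr_ge0 ?invr_ge0 ?(ltW eta0) // (dispersion_ge0 M_avg M_bounded).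
have hphi : level_avg N phi Q < p^-1.
  rewrite level_avgD level_avgZ.
  have h1 : level_avg N (fun P => (polluted bad W (N + e) Q P.2)%:R) Q <= (2 * p)^-1.
    apply: le_trans (level_avg_polluted bad W0 (N := N) (e := e) _) _; first by rewrite addnA.
    rewrite divff ?gt_eqF ?side_gt0 // expr1n mulr1.
    set C := (_ + _) ^+ n in hvar *.
    have C0 : 0 <= C by rewrite exprn_ge0 // addr_ge0 ?exprn_ge0 // mulr_ge0.
    have hb := bad_mass_le (M^~ Q) (N + e) Q lam0.
    have hv := level_avg_sq_dist M_avg M_bounded (N + e) Q.
    rewrite -[_^-1]mul1r ler_pdivlMr ?mulr_gt0 // -(ler_pM2l lam0) mulr1.
    apply: le_trans hvar; rewrite -/p.
    rewrite [leLHS](_ : _ = (lam * bad_mass bad (N + e) Q) * (C * (2 * p))); last by ring.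
    rewrite -[leRHS]mulrA; apply: ler_wpM2r; last exact: le_trans hb hv.
    by rewrite mulr_ge0 // mulr_ge0 // ltW.
  have h2 : eta^-1 * level_avg N (dispersion M) Q <= (4 * p)^-1.
    by rewrite -(ler_pM2l eta0) mulrA divff ?gt_eqF // mul1r.
  apply: le_lt_trans (lerD h1 h2) _.
  rewrite !invfM -mulrDl -[ltRHS]mul1r ltr_pM2r ?invr_gt0 //; lra.
pose s1 : {ffun 'I_n -> bool} := [ffun=> true].
pose s0 : {ffun 'I_n -> bool} := [ffun=> false].
(* The grandchild occupying [1/2, 3/4] of [Q] in every coordinate; it keeps the selected cube away
   from the boundary of [Q]. *)
set Q1 := child (child Q s1) s0.
have hQ1 : level_avg N0 phi Q1 < 1.
  have : (2 ^+ n)^-1 * ((2 ^+ n)^-1 * level_avg N0 phi Q1) < p^-1.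
    apply: le_lt_trans hphi; rewrite /N /=.
    apply: le_trans (avg_ge s1 _); last first.
      by move=> s; exact: (level_avg_ge0 N0.+1 (child Q s) phi0).
    apply: ler_wpM2l; first by rewrite invr_ge0 exprn_ge0.
    apply: (avg_ge (phi := fun s => level_avg N0 phi (child (child Q s1) s))).
    by move=> s; exact: level_avg_ge0.
  rewrite mulrA -invfM -expr2 -/p -{2}[p^-1]mulr1 ltr_pM2l ?invr_gt0 //.
have [P hP phiP] := level_avg_exists_lt hQ1.
exists N, P; split.
- by exists s1, s0.
- move=> i; have [] := descendant_box hP i; rewrite /Q1 /= !mxE !ffunE /=.
  have := sideS R Q.1; have := sideS R Q.1.+1; lra.
- have : eta^-1 * dispersion M P < 1.
    by apply: le_lt_trans phiP; rewrite lerDr ler0n.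
  by rewrite mulrC ltr_pdivrMr // mul1r => /ltW.
- move=> i D hi hD hx; rewrite leNgt; apply/negP => bD.
  move: phiP; rewrite /phi (polluted_intro hi hD bD hx) ltNge => /negP; apply.
  by rewrite lerDl mulr_ge0 ?invr_ge0 ?(ltW eta0) // (dispersion_ge0 M_avg M_bounded).
Qed.

End GoodCube.

(** * Mean gradients of a Lipschitz function *)

Section MatrixNorm.
Variables (R : realType) (m n : nat).

Lemma mx_entry_le_norm (A : 'M[R]_(m, n)) i j : `|A i j| <= `|A|.
Proof.
rewrite [leRHS]/Num.Def.normr/= mx_normrE; apply/bigmax_geP; right => /=.
by exists (i, j).
Qed.

Lemma mx_norm_le (A : 'M[R]_(m, n)) c : 0 <= c ->
  (forall i j, `|A i j| <= c) -> `|A| <= c.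
Proof.
move=> c0 h; rewrite [leLHS]/Num.Def.normr/= mx_normrE.
by apply: bigmax_le => // -[i j] _; exact: h.
Qed.

End MatrixNorm.

Section GeometricConvergence.
Variables (R : realType).

Lemma cvg_side : side R @ \oo --> (0 : R).
Proof. by apply: cvg_expr; rewrite gtr0_norm; lra. Qed.

Lemma geometric_cvg (u : nat -> R) c :
  (forall d, `|u d.+1 - u d| <= c * side R d) ->
  exists l, u @ \oo --> l /\ forall d, `|u d - l| <= 2 * c * side R d.
Proof.
move=> h.
have c0 : 0 <= c by have := le_trans (normr_ge0 _) (h 0%N); rewrite /side expr0 mulr1.
have cs d : 0 <= c * side R d by rewrite mulr_ge0 // ltW // side_gt0.
have up d e : u (d + e)%N <= u d + 2 * (c * side R d) - 2 * (c * side R (d + e)).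
  elim: e => [|e IH]; first by rewrite addn0; lra.
  have := h (d + e)%N; rewrite addnS ler_distl => /andP[_].
  by rewrite (sideS R (d + e)) in IH *; lra.
have dn d e : u d - 2 * (c * side R d) + 2 * (c * side R (d + e)) <= u (d + e)%N.
  elim: e => [|e IH]; first by rewrite addn0; lra.
  have := h (d + e)%N; rewrite addnS ler_distl => /andP[+ _].
  by rewrite (sideS R (d + e)) in IH *; lra.
(* Subtracting the geometric tail that bounds all later increments makes the sequence monotone. *)
pose v d := u d - 2 * (c * side R d).
have vmono : nondecreasing_seq v.
  apply/nondecreasing_seqP => d; rewrite /v; have := dn d 1%N.
  by rewrite addn1; have := cs d.+1; lra.
have vcvg : cvgn v.
  apply: nondecreasing_is_cvgn => //; exists (u 0%N + 2 * (c * side R 0)) => _ [d _ <-].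
  by have := up 0%N d; rewrite add0n /v; have := cs d; lra.
have hs : (fun d => 2 * c * side R d) @ \oo --> 2 * c * 0.
  by apply: cvgMl_tmp; exact: cvg_side.
have hu : u @ \oo --> limn v.
  have -> : u = (fun d => v d + 2 * c * side R d).
    by apply/funext => d; rewrite /v mulrA subrK.
  by rewrite -[limn v]addr0 -[X in _ + X](mulr0 (2 * c)); apply: cvgD.
exists (limn v); split=> // d; rewrite ler_distlC; apply/andP; split.
  have : v d <= limn v by exact: nondecreasing_cvgn_le.
  by rewrite /v; lra.
apply: limr_le => //; exists d => // e /= de.
by have := up d (e - d)%N; rewrite subnKC // /v; have := cs e; lra.
Qed.

End GeometricConvergence.

Section AveragedGradient.
Variables (R : realType) (n : nat) (g : 'rV[R]_n -> R) (L : R).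
Hypothesis g_lip : forall x y, `|g x - g y| <= L * `|x - y|.
Hypothesis L_ge0 : 0 <= L.

Definition bitv_face (i : 'I_n) (s : {ffun 'I_n -> bool}) : 'rV[R]_n :=
  \row_k (s k && (k != i))%:R.

(** Bit [i] of [s] is ignored, so each subcube of the face is counted twice. The average is
    unaffected, and faces and cubes share the index type of [avg]. *)
Definition face_child (i : 'I_n) (Q : cube R n) (s : {ffun 'I_n -> bool}) : cube R n :=
  (Q.1.+1, Q.2 + side R Q.1.+1 *: bitv_face i s).

(* Average of [g] over a dyadic grid of depth [d] in the lower [i]-face of [Q]. *)
Fixpoint face_avg (i : 'I_n) (d : nat) (Q : cube R n) : R :=
  if d is d'.+1 then avg (fun s => face_avg i d' (face_child i Q s)) else g Q.2.

(** The integral mean of [g] over the lower [i]-face, as a limit of Riemann sums that converge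
    geometrically because [g] is Lipschitz. *)
Definition face_mean (i : 'I_n) (Q : cube R n) : R := limn (face_avg i ^~ Q).

Lemma norm_bitv_face i s : `|bitv_face i s| <= 1.
Proof.
apply: mx_norm_le => // a k; rewrite mxE; case: (_ && _); by rewrite ?normr1 ?normr0.
Qed.

Lemma avg_dist (phi psi : {ffun 'I_n -> bool} -> R) c :
  (forall s, `|phi s - psi s| <= c) -> `|avg phi - avg psi| <= c.
Proof.
move=> h; rewrite ler_distl -[avg psi - c](_ : avg (fun s => psi s + - c) = _); last first.
  by rewrite avgD avg_cst.
rewrite -[avg psi + c](_ : avg (fun s => psi s + c) = _); last by rewrite avgD avg_cst.
by apply/andP; split; apply: avg_le => s; have := h s; rewrite ler_distl => /andP[].
Qed.

Lemma face_avgS i d Q : `|face_avg i d.+1 Q - face_avg i d Q| <= L * side R (Q.1 + d.+1).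
Proof.
elim: d Q => [|d IH] Q; last first.
  by apply: avg_dist => s; apply: le_trans (IH _) _; rewrite /= addSnnS.
rewrite /= -(avg_cst n (g Q.2)); apply: avg_dist => s /=.
apply: le_trans (g_lip _ _) _; rewrite addrC addKr normrZ addn1.
rewrite ler_wpM2l // gtr0_norm ?side_gt0 // ler_piMr ?norm_bitv_face //.
exact: ltW (side_gt0 _ _).
Qed.

Lemma face_avg_limit i Q : exists l, face_avg i ^~ Q @ \oo --> l /\
  forall d, `|face_avg i d Q - l| <= 2 * (L * side R Q.1.+1) * side R d.
Proof.
apply: geometric_cvg => d; apply: le_trans (face_avgS i d Q) _.
by rewrite addnS -addSn sideD mulrA.
Qed.

Lemma face_mean_cvg i Q : face_avg i ^~ Q @ \oo --> face_mean i Q.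
Proof.
by have [l [hl _]] := face_avg_limit i Q; apply/cvg_ex; exists l.
Qed.

Lemma face_mean_near i Q : `|face_mean i Q - g Q.2| <= L * side R Q.1.
Proof.
have [l [hl /(_ 0%N)]] := face_avg_limit i Q.
rewrite /face_mean (cvg_lim _ hl) // distrC /= [side R 0]expr0 mulr1 (sideS R Q.1).
by lra.
Qed.

Lemma face_avg_lip i d j a b :
  `|face_avg i d (j, a) - face_avg i d (j, b)| <= L * `|a - b|.
Proof.
elim: d j a b => [|d IH] j a b /=; first exact: g_lip.
apply: avg_dist => s; apply: le_trans (IH _ _ _) _.
by rewrite /= opprD addrACA subrr addr0.
Qed.

Lemma face_mean_lip i j a b :
  `|face_mean i (j, a) - face_mean i (j, b)| <= L * `|a - b|.
Proof.
have h : (fun d => `|face_avg i d (j, a) - face_avg i d (j, b)|) @ \oo -->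
    `|face_mean i (j, a) - face_mean i (j, b)|.
  by apply: cvg_norm; apply: cvgB; exact: face_mean_cvg.
rewrite -(cvg_lim _ h) //; apply: limr_le; first by apply/cvg_ex; eexists; exact: h.
by apply: nearW => d; exact: face_avg_lip.
Qed.

Lemma face_mean_avg i Q : face_mean i Q = avg (fun s => face_mean i (face_child i Q s)).
Proof.
have h1 : (fun d => face_avg i d.+1 Q) @ \oo --> face_mean i Q.
  by rewrite (cvg_shiftS (face_avg i ^~ Q)); exact: face_mean_cvg.
have h2 : (fun d => face_avg i d.+1 Q) @ \oo -->
    avg (fun s => face_mean i (face_child i Q s)).
  rewrite /= /avg; apply: cvgMl_tmp.
  apply: cvg_big => //= [|s _]; [exact: add_continuous|exact: face_mean_cvg].
exact: (cvg_unique _ h1 h2).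
Qed.

(** By the fundamental theorem of calculus this is the mean of the [i]-th partial derivative over
    [Q], written without derivatives. *)
Definition mean_grad (i : 'I_n) (Q : cube R n) : R :=
  (face_mean i (Q.1, Q.2 + side R Q.1 *: 'e_i) - face_mean i Q) / side R Q.1.

Lemma mean_grad_bounded i Q : `|mean_grad i Q| <= L.
Proof.
case: Q => j a; have s0 := side_gt0 R j.
rewrite normrM normfV /= (gtr0_norm s0) ler_pdivrMr //.
apply: le_trans (face_mean_lip _ _ _ _) _.
rewrite addrC addKr normrZ (gtr0_norm s0) ler_wpM2l // ler_piMr ?(ltW s0) //.
apply: mx_norm_le => // b k.
by rewrite mxE; case: (_ && _); rewrite ?normr1 ?normr0.
Qed.

(** [flip] pairs the two children adjacent along axis [i]: their common face cancels, and the outer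
    faces make up the two faces of [Q]. *)
Lemma mean_grad_avg i Q : mean_grad i Q = avg (fun s => mean_grad i (child Q s)).
Proof.
pose flip (s : {ffun 'I_n -> bool}) : {ffun 'I_n -> bool} :=
  [ffun k => if k == i then ~~ s k else s k].
have flipK : involutive flip.
  by move=> s; apply/ffunP => k; rewrite !ffunE; case: eqP => // _; rewrite negbK.
set h := side R Q.1.+1; have h0 : 0 < h by exact: side_gt0.
pose phi a := face_mean i (Q.1.+1, a).
pose F s := phi (Q.2 + h *: bitv R s + h *: 'e_i) - phi (Q.2 + h *: bitv R s).
have -> : avg (fun s => mean_grad i (child Q s)) = h^-1 * avg F.
  by rewrite -avgZ; apply: eq_avg => s; rewrite /mean_grad mulrC.
have bitvE s : bitv R s = bitv_face i s + (s i)%:R *: 'e_i.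
  apply/rowP => k; rewrite !mxE eqxx /= eq_sym.
  by case: (eqVneq i k) => [<-|_]; rewrite ?andbF ?andbT ?mulr1 ?mulr0 ?add0r ?addr0.
have faceE s : bitv_face i (flip s) = bitv_face i s.
  by apply/rowP => k; rewrite !mxE ffunE; case: eqP; rewrite ?andbF.
have hh : side R Q.1 *: 'e_i = h *: 'e_i + h *: 'e_i :> 'rV[R]_n.
  by rewrite (sideS R Q.1) scalerDl.
have FF s : F s + F (flip s) =
    phi (Q.2 + side R Q.1 *: 'e_i + h *: bitv_face i s) - phi (Q.2 + h *: bitv_face i s).
  set p := Q.2 + h *: bitv_face i s.
  have -> : Q.2 + side R Q.1 *: 'e_i + h *: bitv_face i s = p + h *: 'e_i + h *: 'e_i.
    by rewrite hh /p -!addrA; congr (_ + _); rewrite addrA addrC.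
  rewrite /F !bitvE faceE !scalerDr !addrA -/p ffunE eqxx.
  by case: (s i); rewrite /= ?scale0r ?scaler0 ?scale1r ?addr0;
    move: (phi (p + _ + _)) (phi (p + _)) (phi p) => u v w; lra.
have sumF : \sum_s F s = \sum_s F (flip s).
  by rewrite (reindex_inj (inv_inj flipK)).
have avgF : 2 * avg F = side R Q.1 * mean_grad i Q.
  rewrite mulrC [RHS]mulrC /mean_grad divfK ?gt_eqF ?side_gt0 // mulrC.
  have -> : 2 * avg F = avg (fun s => F s + F (flip s)).
    by rewrite avgD {3}/avg -sumF -/(avg F); lra.
  rewrite (face_mean_avg i (_, _)) (face_mean_avg i Q) /avg -mulrBr -sumrB.
  by congr (_ * _); apply: eq_bigr => s _; rewrite FF.
apply: (mulfI (lt0r_neq0 (side_gt0 R Q.1))); rewrite -avgF (sideS R Q.1) -/h.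
by field; rewrite gt_eqF.
Qed.

Lemma mean_grad_telescope i j a T :
  side R j * \sum_(t < T) mean_grad i (j, a + (t%:R * side R j) *: 'e_i) =
  face_mean i (j, a + (T%:R * side R j) *: 'e_i) - face_mean i (j, a).
Proof.
elim: T => [|T IH]; first by rewrite big_ord0 mulr0 mul0r scale0r addr0 subrr.
rewrite big_ord_recr mulrDr IH /= [X in _ + X]mulrC /mean_grad divfK; last first.
  by rewrite gt_eqF // side_gt0.
rewrite /= -(addrA a) -scalerDl -[T.+1%:R]natr1 mulrDl mul1r.
by rewrite [LHS]addrC subrKA.
Qed.

Lemma mean_grad_row i j a T A eps :
  (forall t, (t < T)%N ->
     `|mean_grad i (j, a + (t%:R * side R j) *: 'e_i) - A| <= eps) ->
  `|g (a + (T%:R * side R j) *: 'e_i) - g a - T%:R * side R j * A| <=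
    T%:R * side R j * eps + 2 * (L * side R j).
Proof.
move=> h.
have s0 := side_gt0 R j.
have tele : `|face_mean i (j, a + (T%:R * side R j) *: 'e_i) - face_mean i (j, a) -
    T%:R * side R j * A| <= T%:R * side R j * eps.
  rewrite -mean_grad_telescope [T%:R * _]mulrC -!mulrA -mulrBr normrM (gtr0_norm s0).
  have eT (c : R) : T%:R * c = \sum_(t < T) c by rewrite sumr_const card_ord mulr_natl.
  rewrite ler_pM2l // !eT -sumrB.
  apply: le_trans (ler_norm_sum _ _ _) _; apply: ler_sum => t _.
  exact: h.
have := face_mean_near i (j, a + (T%:R * side R j) *: 'e_i).
have := face_mean_near i (j, a).
move: tele; rewrite /= !ler_distl => /andP[? ?] /andP[? ?] /andP[? ?].
by apply/andP; split; lra.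
Qed.

End AveragedGradient.

Section GridPath.
Variables (R : realType) (n : nat) (g : 'rV[R]_n -> R) (L : R).
Hypothesis g_lip : forall x y, `|g x - g y| <= L * `|x - y|.
Hypothesis L_ge0 : 0 <= L.
Variables (j : nat) (a : 'rV[R]_n).

Definition gridpt (w : 'I_n -> nat) : 'rV[R]_n := a + side R j *: \row_i (w i)%:R.

Lemma gridpt_shift (w w' : 'I_n -> nat) k t :
  (forall i, w' i = (w i + (i == k) * t)%N) ->
  gridpt w' = gridpt w + (t%:R * side R j) *: 'e_k.
Proof.
move=> h; apply/rowP => i; rewrite !mxE h eqxx /= natrD eq_sym.
by case: (k == i); rewrite ?mul1n ?mul0n /=; ring.
Qed.

Lemma mean_grad_step (w w' : 'I_n -> nat) k A eps :
  (forall i, i != k -> w' i = w i) ->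
  (forall v : 'I_n -> nat,
     (forall i, minn (w i) (w' i) <= v i <= maxn (w i) (w' i))%N ->
     `|mean_grad g k (j, gridpt v) - A| <= eps) ->
  `|g (gridpt w') - g (gridpt w) - side R j * ((w' k)%:R - (w k)%:R) * A| <=
    side R j * `|(w' k)%:R - (w k)%:R| * eps + 2 * (L * side R j).
Proof.
wlog le_ww : w w' / (w k <= w' k)%N => [hw|] eqw h.
  case: (leqP (w k) (w' k)) => [le|/ltnW le]; first exact: hw.
  rewrite distrC -[X in `|X| <= _]opprK normrN.
  have -> : - (side R j * ((w' k)%:R - (w k)%:R) * A - (g (gridpt w') - g (gridpt w))) =
    - (g (gridpt w) - g (gridpt w') - side R j * ((w k)%:R - (w' k)%:R) * A) by ring.
  rewrite normrN [`|(w' k)%:R - _|]distrC; apply: hw => //.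
    by move=> i /eqw.
  by move=> v hv; apply: h => i; rewrite minnC maxnC.
set T := (w' k - w k)%N.
have TE : (w' k)%:R - (w k)%:R = T%:R :> R by rewrite natrB.
rewrite TE normr_nat.
have -> : gridpt w' = gridpt w + (T%:R * side R j) *: 'e_k.
  apply: gridpt_shift => i; case: eqVneq => [->|/eqw ->]; last by rewrite addn0.
  by rewrite mul1n subnKC.
rewrite [side R j * _]mulrC.
apply: (mean_grad_row g_lip L_ge0) => t tT.
pose v i := (w i + (i == k) * t)%N.
rewrite -(@gridpt_shift w v) //; apply: h => i; rewrite /v.
case: (eqVneq i k) => [->|/eqw ->]; last by rewrite mul0n addn0 minnn maxnn leqnn.
rewrite mul1n (minn_idPl le_ww) (maxn_idPr le_ww) leq_addr /=.
by rewrite -(subnKC le_ww) leq_add2l ltnW.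
Qed.

(** The path changes one coordinate at a time, [mix k] having the first [k] coordinates of [z']. Its
    cubes have corners coordinatewise between [z] and [z'], so the gradient has to be controlled
    only there. Each leg pays [2 * (L * side R j)] for replacing face means by values of [g]. *)
Lemma mean_grad_path (z z' : 'I_n -> nat) (A : 'I_n -> R) eps D :
  0 <= eps ->
  (forall i, side R j * `|(z' i)%:R - (z i)%:R| <= D) ->
  (forall v : 'I_n -> nat,
     (forall i, minn (z i) (z' i) <= v i <= maxn (z i) (z' i))%N ->
     forall k, `|mean_grad g k (j, gridpt v) - A k| <= eps) ->
  `|g (gridpt z') - g (gridpt z) -
     \sum_i side R j * ((z' i)%:R - (z i)%:R) * A i| <=
   n%:R * (D * eps + 2 * (L * side R j)).
Proof.
move=> eps0 hD h.
pose mix k (i : 'I_n) := if (i < k)%N then z' i else z i.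
have mix_between k (i : 'I_n) : (minn (z i) (z' i) <= mix k i <= maxn (z i) (z' i))%N.
  by rewrite /mix; case: ifP => _; rewrite ?geq_minl ?geq_minr ?leq_maxl ?leq_maxr.
have main k : (k <= n)%N -> `|g (gridpt (mix k)) - g (gridpt z) -
     \sum_(i < n | (i < k)%N) side R j * ((z' i)%:R - (z i)%:R) * A i| <=
   k%:R * (D * eps + 2 * (L * side R j)).
  elim: k => [|k IH] kn.
    rewrite big_pred0 // subr0 mul0r (_ : mix 0%N = z) ?subrr ?normr0 //.
  pose K := Ordinal kn.
  have -> : \sum_(i < n | (i < k.+1)%N) side R j * ((z' i)%:R - (z i)%:R) * A i =
     side R j * ((z' K)%:R - (z K)%:R) * A K +
     \sum_(i < n | (i < k)%N) side R j * ((z' i)%:R - (z i)%:R) * A i.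
    rewrite (bigD1 K) //=; congr (_ + _); apply: eq_bigl => i.
    by rewrite ltnS -val_eqE /= ltn_neqAle andbC.
  have step : `|g (gridpt (mix k.+1)) - g (gridpt (mix k)) -
      side R j * ((z' K)%:R - (z K)%:R) * A K| <= D * eps + 2 * (L * side R j).
    have mK : mix k.+1 K = z' K by rewrite /mix /= ltnSn.
    have mK' : mix k K = z K by rewrite /mix /= ltnn.
    rewrite -{1}mK -{1}mK'; apply: le_trans.
      apply: (@mean_grad_step (mix k) (mix k.+1) K (A K) eps) => [i iK|v hv].
        rewrite /mix ltnS [(i <= k)%N]leq_eqVlt.
        by move: iK; rewrite -val_eqE /= => /negbTE ->.
      apply: h => i; have /andP[v1 v2] := hv i.
      have /andP[a1 a2] := mix_between k i; have /andP[b1 b2] := mix_between k.+1 i.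
      apply/andP; split.
        by apply: leq_trans v1; rewrite leq_min a1.
      by apply: (leq_trans v2); rewrite geq_max a2.
    by rewrite mK mK' lerD2r ler_wpM2r.
  have hk := IH (ltnW kn).
  rewrite (_ : g (gridpt (mix k.+1)) - _ - _ =
    (g (gridpt (mix k)) - g (gridpt z) -
     \sum_(i < n | (i < k)%N) side R j * ((z' i)%:R - (z i)%:R) * A i) +
    (g (gridpt (mix k.+1)) - g (gridpt (mix k)) -
      side R j * ((z' K)%:R - (z K)%:R) * A K)); last by ring.
  apply: le_trans (ler_normD _ _) _.
  by rewrite -[k.+1%:R]natr1 mulrDl mul1r; exact: lerD hk step.
have := main n (leqnn n); rewrite (_ : mix n = z'); last first.
  by apply/funext => i; rewrite /mix ltn_ord.
by rewrite (eq_bigl xpredT) // => i; rewrite ltn_ord.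
Qed.

End GridPath.

(** * Points of differentiability *)

Section NestedCubes.
Variables (R : realType) (n : nat) (K : finType) (M : K -> cube R n -> R) (L : R).
Hypothesis M_avg : forall k Q, M k Q = avg (fun s => M k (child Q s)).
Hypothesis M_bounded : forall k Q, `|M k Q| <= L.

Lemma nested_cubes (kap : nat -> R) (W e : nat -> nat) (a : K -> R) c Q0 :
  (forall s, 0 < kap s) -> (forall s, (0 < W s)%N) ->
  \sum_k a k * M k Q0 < c ->
  exists (d0 : nat) (d : nat -> nat) (Q : nat -> cube R n),
  [/\ descendant d0 Q0 (Q 0%N), \sum_k a k * M k (Q 0%N) < c,
    forall s, descendant (d s) (Q s) (Q s.+1),
    forall s i, (Q s).2 0 i + side R (Q s).1 / 2 <= (Q s.+1).2 0 i /\
      (Q s.+1).2 0 i + side R (Q s.+1).1 <= (Q s).2 0 i + side R (Q s).1 * (3 / 4) &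
    forall s i D, (i <= d s + e s)%N -> descendant i (Q s) D -> enlarged (W s) D (Q s.+1).2 ->
      forall k, `|M k D - M k (Q s)| <= kap s].
Proof.
move=> kap0 W0 hc.
pose C s : R := (2 * (W s)%:R + 2 ^+ e s) ^+ n * (2 * (2 ^+ n) ^+ 2).
have C0 s : 0 < C s by rewrite !mulr_gt0 ?exprn_gt0 // addr_gt0 ?exprn_gt0 // mulr_gt0 ?ltr0n.
(* The dispersion that [good_subcube] tolerates at stage [s] when the threshold for [sq_dist] is
   [kap s ^+ 2]. Each stage delivers a cube already meeting the requirement of the next one. *)
pose eta s := kap s ^+ 2 / C s.
have eta0 s : 0 < eta s by rewrite divr_gt0 // exprn_gt0.
have [d0 [P0 [hd0 hP0 hv0]]] := dispersion_descent M_avg M_bounded (eta0 0%N) hc.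
have step (sQ : nat * cube R n) : exists dP : nat * cube R n,
  dispersion M sQ.2 <= eta sQ.1 ->
  [/\ descendant dP.1 sQ.2 dP.2,
    forall i, sQ.2.2 0 i + side R sQ.2.1 / 2 <= dP.2.2 0 i /\
              dP.2.2 0 i + side R dP.2.1 <= sQ.2.2 0 i + side R sQ.2.1 * (3 / 4),
    dispersion M dP.2 <= eta sQ.1.+1 &
    forall i D, (i <= dP.1 + e sQ.1)%N -> descendant i sQ.2 D -> enlarged (W sQ.1) D dP.2.2 ->
      sq_dist M (M^~ sQ.2) D <= kap sQ.1 ^+ 2].
  (* [(0, Q)] is a dummy value that makes the step total for [choice]; the invariant [hdisp]
     excludes this case along the sequence. *)
  case: sQ => s Q /=; case: (leP (dispersion M Q) (eta s)) => h; last by exists (0%N, Q).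
  have k2 : 0 < kap s ^+ 2 by rewrite exprn_gt0.
  have [|d [P hP]] := @good_subcube _ _ _ _ _ M_avg M_bounded (W s) (e s) _ _ Q
    (W0 s) k2 (eta0 s.+1).
    by rewrite -mulrA -ler_pdivlMr.
  by exists (d, P).
have [nxt hnxt] := choice step.
pose Q := fix Q s := if s is s'.+1 then (nxt (s', Q s')).2 else P0.
pose d s := (nxt (s, Q s)).1.
have hdisp s : dispersion M (Q s) <= eta s.
  by elim: s => [//|s IH] /=; have [] := hnxt (s, Q s) IH.
exists d0, d, Q; split => //.
- by move=> s; have [] := hnxt (s, Q s) (hdisp s).
- by move=> s; have [] := hnxt (s, Q s) (hdisp s).
- move=> s i D hi hD hx k; have [_ _ _ /(_ i D hi hD hx)] := hnxt (s, Q s) (hdisp s).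
  rewrite /= => h; rewrite -ler_sqr ?nnegrE ?(ltW (kap0 s)) //.
  rewrite real_normK ?num_real //; apply: le_trans h.
  by rewrite /sq_dist (bigD1 k) //= lerDl; apply: sumr_ge0 => ? _; exact: sqr_ge0.
Qed.

End NestedCubes.

Definition has_jacobian (R : realType) (n m : nat) (F : 'rV[R]_n -> 'rV[R]_m)
    (x : 'rV[R]_n) (A : 'M[R]_(n, m)) : Prop :=
  forall eps, 0 < eps -> exists2 delta, 0 < delta &
    forall y, `|y - x| < delta -> `|F y - F x - (y - x) *m A| <= eps * `|y - x|.

Section Rademacher.
Variables (R : realType) (n' m : nat).
Let n := n'.+1.
Variables (F : 'rV[R]_n -> 'rV[R]_m) (L : R).
Hypothesis F_lip : forall x y, `|F x - F y| <= L * `|x - y|.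
Hypothesis L_ge0 : 0 <= L.

Definition coord_grad (k : 'I_n * 'I_m) (Q : cube R n) : R :=
  mean_grad (fun x => F x 0 k.2) k.1 Q.

Lemma coord_lip k x y : `|F x 0 k - F y 0 k| <= L * `|x - y|.
Proof.
apply: le_trans (F_lip x y).
by have := mx_entry_le_norm (F x - F y) 0 k; rewrite !mxE.
Qed.

Lemma coord_grad_avg k Q : coord_grad k Q = avg (fun s => coord_grad k (child Q s)).
Proof. exact: (mean_grad_avg (@coord_lip _) L_ge0). Qed.

Lemma coord_grad_bounded k Q : `|coord_grad k Q| <= L.
Proof. exact: (mean_grad_bounded (@coord_lip _) L_ge0). Qed.

Lemma exists_side_le (eps : R) : 0 < eps -> exists s, side R s <= eps.
Proof.
move=> eps0; have /cvgrPdist_le /(_ eps eps0) [N _ hN] := @cvg_side R.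
exists N; have := hN N (leqnn _); rewrite sub0r normrN gtr0_norm //; exact: side_gt0.
Qed.

(** For [y] at distance r from [x], the stage [s] is the one whose cube is just large enough to
    contain the surroundings of size r. Inside it [x] and [y] are rounded to a grid of step about r
    2^-s and joined by an axis-parallel path; all cubes on the path have gradient within
    [3 * k0 * side R s] of [l]. Every error is O(r 2^-s), hence o(r). *)
Lemma jacobian_of_nested (k0 : R) (d : nat -> nat) (Q : nat -> cube R n)
    (x : 'rV[R]_n) (l : 'I_n * 'I_m -> R) :
  0 < k0 ->
  (forall s, descendant (d s) (Q s) (Q s.+1)) ->
  (forall s, side R (Q s).1 <= side R (Q 0%N).1 * side R s) ->
  (forall s i, (Q s).2 0 i + side R (Q s).1 / 2 <= x 0 i /\
     x 0 i <= (Q s).2 0 i + side R (Q s).1 * (3 / 4)) ->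
  (forall s i D, (i <= d s + (s + 5))%N -> descendant i (Q s) D ->
     enlarged (2 ^ (s + 6)) D (Q s.+1).2 ->
     forall k, `|coord_grad k D - coord_grad k (Q s)| <= k0 * side R s) ->
  (forall k s, `|coord_grad k (Q s) - l k| <= 2 * k0 * side R s) ->
  has_jacobian F x (\matrix_(i, k) l (i, k)).
Proof.
move=> k00 hd Hside xmid hgood hl.
pose H s := side R (Q s).1.
have H0 s : 0 < H s by exact: side_gt0.
have Hd s : H s.+1 = H s * side R (d s) by rewrite /H (descendant_level (hd s)) sideD.
(* The errors in units of r 2^-s: rounding the two endpoints, the path, and the rounded displacement
   in the linear term. The final 1 keeps the constant positive. *)
pose CC := 2 * L + n%:R * (6 * k0 + 2 * L) + n%:R * (L + 2 * k0) + 1.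
have n0 : (0 : R) <= n%:R by rewrite ler0n.
have CC0 : 0 < CC.
  by rewrite ltr_pwDr // !addr_ge0 ?mulr_ge0 ?addr_ge0 ?mulr_ge0 // ltW.
have lB k : `|l k| <= L + 2 * k0.
  have := hl k 0%N; rewrite [side R 0]expr0 mulr1 distrC => h.
  rewrite -(subrK (coord_grad k (Q 0%N)) (l k)); apply: le_trans (ler_normD _ _) _.
  by rewrite addrC lerD // coord_grad_bounded.
move=> eps eps0; have [s0 hs0] := exists_side_le (divr_gt0 eps0 CC0).
exists (H s0 / 16); first by rewrite divr_gt0.
move=> y; set r := `|y - x| => hr.
have [r0|r0] : r = 0 \/ 0 < r by have := normr_ge0 (y - x); rewrite -/r; lra.
  have /eqP : `|y - x| == 0 by apply/eqP.
  move/normr0_eq0 => yx; rewrite yx mul0mx subr0.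
  by move/eqP: yx; rewrite subr_eq0 => /eqP ->; rewrite subrr normr0 r0 mulr0.
(* the stage whose range of scales contains [r] *)
have [s [ss0 rs rs']] : exists s, [/\ (s0 <= s)%N, H s.+1 < 16 * r & 16 * r <= H s].
  pose P s := (s0 <= s)%N && (H s.+1 < 16 * r).
  have exP : exists s, P s.
    have rH : 0 < r / H 0%N by rewrite divr_gt0.
    have [N hN] := exists_side_le rH.
    exists (s0 + N)%N; rewrite /P leq_addr /=; apply: le_lt_trans (Hside _) _.
    apply: (@le_lt_trans _ _ (H 0%N * side R N)).
      by rewrite ler_wpM2l ?(ltW (H0 0%N)) // side_le // leqW // leq_addl.
    by move: hN; rewrite ler_pdivlMr // mulrC; lra.
  case: (ex_minnP exP) => s /andP[ss0 hs] smin; exists s; split => //.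
  move: ss0; rewrite leq_eqVlt => /orP[/eqP <-|]; first by move: hr; lra.
  case: s hs smin => // s hs smin; rewrite ltnS => ss0; rewrite leNgt; apply/negP => h.
  by have := smin s; rewrite /P ss0 h => /(_ isT); rewrite ltnn.
(* The grid step [rho] lies between r 2^-s / 2 and r 2^-s: fine enough for negligible rounding,
   coarse enough to stay within the controlled depth. *)
have [i [irho1 irho2]] : exists i, H s * side R i <= r * side R s /\
    r * side R s < 2 * (H s * side R i).
  pose P i := H s * side R i <= r * side R s.
  have exP : exists i, P i.
    have rH : 0 < r * side R s / H s by rewrite divr_gt0 // mulr_gt0 // side_gt0.
    by have [N hN] := exists_side_le rH; exists N; move: hN; rewrite ler_pdivlMr // mulrC.
  case: (ex_minnP exP) => i hi imin; exists i; split => //.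
  case: i hi imin => [|i] hi imin.
    move: hi; rewrite /P [side R 0]expr0 mulr1.
    have : side R s <= 1 by rewrite -[1](expr0 2^-1); exact: (side_le R (leq0n s)).
    by have := side_gt0 R s; nra.
  rewrite ltNge; apply/negP => h; have := imin i; rewrite ltnn => himin.
  suff : false by []; apply: himin; apply: le_trans h.
  by rewrite (sideS R i); lra.
set rho := H s * side R i in irho1 irho2.
have rho0 : 0 < rho by rewrite mulr_gt0 // side_gt0.
have ss1 : side R s <= 1 by rewrite -[1](expr0 2^-1); exact: (side_le R (leq0n s)).
have rhor : rho <= r by apply: le_trans irho1 _; rewrite ler_piMr // ltW.
(* A deeper grid would have [rho] <= H (s+1) 2^-(s+5) < 16 r 2^-s / 32, below the lower bound on
   [rho]. This is the origin of the 5. *)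
have hi : (i <= d s + (s + 5))%N.
  rewrite leqNgt; apply/negP => h.
  have : rho <= H s.+1 * side R (s + 5).
    by rewrite Hd -mulrA -sideD ler_wpM2l ?(ltW (H0 s)) // side_le // ltnW.
  rewrite sideD mulrA (_ : side R 5 = 32^-1); last by rewrite /side; field.
  have := side_gt0 R s; move: rs irho2; set t := side R s => rs irho2 t0.
  have : H s.+1 * t < 16 * r * t by rewrite ltr_pM2r.
  by lra.
pose a := (Q s).2; pose j := ((Q s).1 + i)%N.
have jrho : side R j = rho by rewrite sideD.
pose gi (u : 'rV[R]_n) k := Num.truncn ((u 0 k - a 0 k) / rho).
have gi_itv (u : 'rV[R]_n) k : a 0 k <= u 0 k ->
    a 0 k + rho * (gi u k)%:R <= u 0 k /\ u 0 k < a 0 k + rho * (gi u k)%:R + rho.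
  move=> au; have /truncn_itv : 0 <= (u 0 k - a 0 k) / rho by rewrite divr_ge0 ?subr_ge0 // ltW.
  rewrite -/(gi u k) ler_pdivlMr // ltr_pdivrMr // -natr1 => /andP[h1 h2].
  by split; lra.
have yx k : `|y 0 k - x 0 k| <= r.
  by have := mx_entry_le_norm (y - x) 0 k; rewrite !mxE.
have hx k : a 0 k + H s / 2 <= x 0 k /\ x 0 k <= a 0 k + H s * (3 / 4) by exact: xmid.
have ax k : a 0 k <= x 0 k by have [] := hx k; have := H0 s; lra.
have ay k : a 0 k <= y 0 k.
  by have [] := hx k; have := yx k; rewrite ler_distl => /andP[]; have := H0 s; lra.
have err (u : 'rV[R]_n) : (forall k, a 0 k <= u 0 k) ->
    `|u - gridpt j a (gi u)| <= rho.
  move=> au; apply: mx_norm_le; first exact: ltW.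
  move=> o k; rewrite ord1 !mxE jrho ler_norml.
  by have [] := gi_itv u k (au k); lra.
have ctrl v : (forall k, minn (gi x k) (gi y k) <= v k <= maxn (gi x k) (gi y k))%N ->
    forall k : 'I_n * 'I_m, `|coord_grad k (j, gridpt j a v) - l k| <= 3 * k0 * side R s.
  move=> hv.
  have vr q : a 0 q + rho * (v q)%:R <= x 0 q + r /\
      x 0 q - r <= a 0 q + rho * (v q)%:R + rho.
    have /andP[v1 v2] := hv q.
    have [x1 x2] := gi_itv x q (ax q); have [y1 y2] := gi_itv y q (ay q).
    have /andP[] : y 0 q - r <= x 0 q <= y 0 q + r by rewrite -ler_distlC.
    move: v1 v2; rewrite geq_min leq_max => /orP v1 /orP v2 xy1 xy2.
    have v1' : (gi x q)%:R <= (v q)%:R :> R \/ (gi y q)%:R <= (v q)%:R :> R.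
      by case: v1; rewrite ler_nat; [left|right]; rewrite ?ler_nat.
    have v2' : (v q)%:R <= (gi x q)%:R :> R \/ (v q)%:R <= (gi y q)%:R :> R.
      by case: v2; [left|right]; rewrite ler_nat.
    by split; [case: v2' => w|case: v1' => w]; rewrite -(ler_pM2l rho0) in w; lra.
  have vi q : (v q < 2 ^ i)%N.
    rewrite -(ltr_nat R) -(ltr_pM2l rho0) natrX.
    have -> : rho * 2 ^+ i = H s.
      by rewrite /rho /side exprVn mulfVK // expf_neq0.
    by have [h1 _] := vr q; have [_ h2] := hx q; have := H0 s; lra.
  move=> k; set D := (j, _).
  have hD : descendant i (Q s) D by exact: descendant_grid.
  (* The corner of [D] is between x - r - rho and x + r, that of the next cube at most 3/4 H (s+1) <
     12 r below [x], while the enlargement has radius 2^(s+6) rho > 32 r. *)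
  have henl : enlarged (2 ^ (s + 6)) D (Q s.+1).2.
    apply/forallP => q; rewrite /D /= !mxE jrho natrX exprD.
    have [q1 q2] := xmid s.+1 q; have [v1 v2] := vr q.
    have r64 : 36 * r <= 2 ^+ s * 2 ^+ 6 * rho * 2.
      have ts : 2 ^+ s * side R s = 1 by rewrite /side exprVn divff // expf_neq0.
      have p0 : 0 < 2 ^+ s :> R by rewrite exprn_gt0.
      have : r < 2 ^+ s * (2 * rho).
        by rewrite [ltLHS](_ : r = 2 ^+ s * (r * side R s)) ?ltr_pM2l // mulrCA ts mulr1.
      by rewrite (_ : 2 ^+ 6 = 64); [lra | ring].
    rewrite ler_distl; have := H0 s.+1; rewrite -/(H s.+1) in q1 q2 => Hs0.
    by apply/andP; split; lra.
  rewrite -(subrKA (coord_grad k (Q s))); apply: le_trans (ler_normD _ _) _.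
  have := hgood s i D hi hD henl k; have := hl k s; lra.
set E := F y - F x - (y - x) *m _.
have hE : `|E| <= CC * (r * side R s).
  have rs0 : 0 <= r * side R s by rewrite mulr_ge0 ?(ltW r0) // ltW // side_gt0.
  apply: mx_norm_le => [|o k]; first by rewrite mulr_ge0 // ltW.
  rewrite ord1 {o} /E !mxE.
  have ke : 0 <= 3 * k0 * side R s by rewrite !mulr_ge0 ?(ltW k00) // ltW // side_gt0.
  have hD q : side R j * `|(gi y q)%:R - (gi x q)%:R| <= 2 * r.
    rewrite jrho -{1}(gtr0_norm rho0) -normrM mulrBr ler_norml.
    have [x1 x2] := gi_itv x q (ax q); have [y1 y2] := gi_itv y q (ay q).
    by have := yx q; rewrite ler_distl => /andP[z1 z2]; apply/andP; split; lra.
  have path := mean_grad_path (g := fun x => F x 0 k) (@coord_lip k) L_ge0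
    ke hD (fun v hv q => ctrl v hv (q, k)).
  have ex := le_trans (coord_lip k x (gridpt j a (gi x))) (ler_wpM2l L_ge0 (err x ax)).
  have ey := le_trans (coord_lip k y (gridpt j a (gi y))) (ler_wpM2l L_ge0 (err y ay)).
  have lin : `|\sum_q side R j * ((gi y q)%:R - (gi x q)%:R) * l (q, k) -
      \sum_q (y - x) 0 q * (\matrix_(i, k) l (i, k)) q k| <= n%:R * (rho * (L + 2 * k0)).
    rewrite -sumrB; apply: le_trans (ler_norm_sum _ _ _) _.
    rewrite mulr_natl -[n in _ *+ n](card_ord n) -sumr_const; apply: ler_sum => q _.
    rewrite !mxE -mulrBl normrM; apply: ler_pM => //.
    have [x1 x2] := gi_itv x q (ax q); have [y1 y2] := gi_itv y q (ay q).
    by rewrite jrho ler_norml; apply/andP; split; lra.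
  set t := r * side R s in irho1 rs0 *.
  have b1 : L * rho <= L * t by exact: ler_wpM2l.
  have b2 : n%:R * (rho * (L + 2 * k0)) <= n%:R * (t * (L + 2 * k0)).
    by rewrite ler_wpM2l // ler_wpM2r // addr_ge0 // mulr_ge0 // ltW.
  have b3 : n%:R * (2 * r * (3 * k0 * side R s) + 2 * (L * side R j)) <=
      n%:R * (6 * k0 * t + 2 * (L * t)).
    rewrite ler_wpM2l // jrho; apply: lerD; last by rewrite ler_wpM2l.
    by rewrite le_eqVlt /t; apply/orP; left; apply/eqP; ring.
  have {}path := le_trans path b3.
  have {}lin := le_trans lin b2.
  have {}ex := le_trans ex b1.
  have {}ey := le_trans ey b1.
  have CCt : CC * t = 2 * (L * t) + n%:R * (6 * k0 * t + 2 * (L * t)) +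
     n%:R * (t * (L + 2 * k0)) + t by rewrite /CC; ring.
  rewrite CCt; move: path lin ex ey rs0.
  rewrite !ler_norml => /andP[? ?] /andP[? ?] /andP[? ?] /andP[? ?] ?.
  by apply/andP; split; lra.
apply: le_trans hE _.
rewrite mulrCA mulrC ler_wpM2r ?(ltW r0) //.
rewrite mulrC -ler_pdivlMr //; apply: le_trans hs0; exact: side_le.
Qed.

Theorem exists_jacobian (a : 'I_n * 'I_m -> R) (c : R) (Q0 : cube R n) :
  \sum_k a k * coord_grad k Q0 < c ->
  exists x A, [/\ has_jacobian F x A,
    forall i, Q0.2 0 i <= x 0 i /\ x 0 i <= Q0.2 0 i + side R Q0.1 &
    \sum_k a k * A k.1 k.2 <= c].
Proof.
move=> hc; set c0 := \sum_k _ in hc; pose gap := c - c0.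
have gap0 : 0 < gap by rewrite subr_gt0.
pose S := \sum_k `|a k| + 1.
have S0 : 0 < S by rewrite ltr_pwDr // sumr_ge0.
(* Half of the gap is kept when selecting [Q 0]; the passage from its gradient to the limit costs at
   most S (2 k0), which is the other half. *)
pose k0 := gap / (4 * S).
have k00 : 0 < k0 by rewrite divr_gt0 // mulr_gt0.
pose kap s := k0 * side R s.
have kap0 s : 0 < kap s by rewrite mulr_gt0 // side_gt0.
have hc' : \sum_k a k * coord_grad k Q0 < c - gap / 2.
  by rewrite -/c0 /gap; move: gap0; rewrite /gap; lra.
have [d0 [d [Q [hQ0 haQ hd hmid hgood]]]] :=
  nested_cubes coord_grad_avg coord_grad_bounded (kap := kap) (W := fun s => (2 ^ (s + 6))%N)
   (fun s => (s + 5)%N) kap0 (fun s => expn_gt0 2 _) hc'.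
pose H s := side R (Q s).1.
have H0 s : 0 < H s by exact: side_gt0.
have HS s : H s.+1 <= H s * 4^-1.
  by have [h1 h2] := hmid s ord0; rewrite -/(H s) -/(H s.+1) in h1 h2; lra.
have Hd s : H s.+1 = H s * side R (d s) by rewrite /H (descendant_level (hd s)) sideD.
have Hside s : H s <= H 0%N * side R s.
  elim: s => [|s IH]; first by rewrite [side R 0]expr0 mulr1.
  apply: le_trans (HS s) _; have := sideS R s; have := H0 s; nra.
have nest t s i : (Q s).2 0 i <= (Q (s + t)%N).2 0 i /\
    (Q (s + t)%N).2 0 i + H (s + t)%N <= (Q s).2 0 i + H s.
  elim: t => [|t [IH1 IH2]]; first by rewrite addn0.
  have [h1 h2] := descendant_box (hd (s + t)%N) i.
  by rewrite addnS; split; rewrite /H in IH2 *; lra.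
pose b i s := (Q s).2 0 i.
have b_mono i : nondecreasing_seq (b i).
  by apply/nondecreasing_seqP => s; have [] := nest 1%N s i; rewrite addn1.
have b_cvg i : cvgn (b i).
  apply: nondecreasing_is_cvgn => //; exists (b i 0%N + H 0%N) => _ [s _ <-].
  by have [_] := nest s 0%N i; rewrite add0n /b; have := H0 s; lra.
pose x : 'rV[R]_n := \row_i limn (b i).
have xQ s i : b i s <= x 0 i /\ x 0 i <= b i s + H s.
  rewrite !mxE; split; first exact: nondecreasing_cvgn_le.
  apply: limr_le => //; exists s => // t /= st.
  by have [_] := nest (t - s)%N s i; rewrite subnKC // /b; have := H0 t; lra.
have xmid s i : b i s + H s / 2 <= x 0 i /\ x 0 i <= b i s + H s * (3 / 4).
  have [h1 h2] := xQ s.+1 i; have [h3 h4] := hmid s i.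
  by rewrite /b /H in h1 h2 *; split; lra.
have hA k : exists l, forall s, `|coord_grad k (Q s) - l| <= 2 * k0 * side R s.
  have [|l [_ hl]] := @geometric_cvg R (fun s => coord_grad k (Q s)) k0; last by exists l.
  (* The next cube is itself a descendant within the controlled depth, and its corner lies in its
     own enlargement; so consecutive gradients are close. *)
  move=> s; apply: (hgood s (d s)) => //; first exact: leq_addr.
  by apply/forallP => i; rewrite subrr normr0 mulr_ge0 ?ler0n // ltW // side_gt0.
have {hA} [l hl] := choice hA.
pose A : 'M[R]_(n, m) := \matrix_(i, k) l (i, k).
exists x, A; split; last 1 first.
- have -> : \sum_k a k * A k.1 k.2 = \sum_k a k * l k.
    by apply: eq_bigr => -[i k] _; rewrite mxE.
  have : `|\sum_k a k * coord_grad k (Q 0%N) - \sum_k a k * l k| <= S * (2 * k0).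
    rewrite -sumrB; apply: le_trans (ler_norm_sum _ _ _) _.
    apply: (@le_trans _ _ (\sum_k `|a k| * (2 * k0))).
      apply: ler_sum => k _; rewrite -mulrBr normrM ler_wpM2l //.
      by have := hl k 0%N; rewrite [side R 0]expr0 mulr1.
    rewrite -mulr_suml; apply: ler_wpM2r; first by rewrite mulr_ge0 // ltW.
    by rewrite /S lerDl.
  have -> : S * (2 * k0) = gap / 2 by rewrite /k0; field; rewrite gt_eqF.
  by rewrite ler_distl => /andP[+ _]; move: haQ; lra.
- by apply: (jacobian_of_nested k00 hd Hside xmid _ hl) => s; exact: hgood.
- move=> i; have [h1 h2] := xQ 0%N i; have [h3 h4] := descendant_box hQ0 i.
  by rewrite /b /H in h1 h2; split; lra.
Qed.

End Rademacher.

(** * The mean value inequality *)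

Section DotProduct.
Variables (R : realType).

(** The Euclidean product, needed for separation arguments; the norm of row vectors is the sup norm,
    so comparing the two costs factors [n]. *)
Definition dot (n : nat) (u v : 'rV[R]_n) : R := \sum_i u 0 i * v 0 i.

Lemma dotDl n (u v p : 'rV[R]_n) : dot (u + v) p = dot u p + dot v p.
Proof. by rewrite /dot -big_split; apply: eq_bigr => i _; rewrite !mxE mulrDl. Qed.

Lemma dotZl n c (u p : 'rV[R]_n) : dot (c *: u) p = c * dot u p.
Proof. by rewrite /dot mulr_sumr; apply: eq_bigr => i _; rewrite !mxE mulrA. Qed.

Lemma dotBl n (u v p : 'rV[R]_n) : dot (u - v) p = dot u p - dot v p.
Proof. by rewrite -scaleN1r dotDl dotZl mulN1r. Qed.

Lemma dotC n (u p : 'rV[R]_n) : dot u p = dot p u.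
Proof. by apply: eq_bigr => i _; rewrite mulrC. Qed.

Lemma dotDr n (u v p : 'rV[R]_n) : dot p (u + v) = dot p u + dot p v.
Proof. by rewrite dotC dotDl ![dot _ p]dotC. Qed.

Lemma dotZr n c (u p : 'rV[R]_n) : dot p (c *: u) = c * dot p u.
Proof. by rewrite dotC dotZl dotC. Qed.

Lemma dotBr n (u v p : 'rV[R]_n) : dot p (u - v) = dot p u - dot p v.
Proof. by rewrite dotC dotBl ![dot _ p]dotC. Qed.

Lemma norm_dot n (u p : 'rV[R]_n) : `|dot u p| <= n%:R * `|u| * `|p|.
Proof.
apply: le_trans (ler_norm_sum _ _ _) _.
rewrite -mulrA mulr_natl -[n in _ *+ n](card_ord n) -sumr_const.
by apply: ler_sum => i _; rewrite normrM ler_pM // mx_entry_le_norm.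
Qed.

Lemma sqr_norm_le_dot n (u : 'rV[R]_n) : `|u| ^+ 2 <= dot u u.
Proof.
have d0 : 0 <= dot u u by apply: sumr_ge0 => i _; rewrite -expr2 sqr_ge0.
rewrite -[leRHS]sqr_sqrtr // ler_sqr ?nnegrE ?sqrtr_ge0 //.
apply: mx_norm_le; rewrite ?sqrtr_ge0 // => o i; rewrite ord1.
rewrite -sqrtr_sqr ler_sqrt // /dot (bigD1 i) //= -expr2 lerDl.
by apply: sumr_ge0 => k _; rewrite -expr2 sqr_ge0.
Qed.

Lemma norm_mulmx n m (u : 'rV[R]_n) (B : 'M[R]_(n, m)) :
  `|u *m B| <= n%:R * `|u| * `|B|.
Proof.
apply: mx_norm_le => [|o k]; first by rewrite !mulr_ge0.
rewrite mxE; apply: le_trans (ler_norm_sum _ _ _) _.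
rewrite -mulrA mulr_natl -[n in _ *+ n](card_ord n) -sumr_const.
by apply: ler_sum => i _; rewrite normrM ler_pM // mx_entry_le_norm.
Qed.

End DotProduct.

Section MeanValue.
Variables (R : realType).

(** Used to turn an arbitrary direction [v] into a coordinate axis, along which dyadic cubes can be
    stacked. *)
Lemma unitmx_with_row n (v : 'rV[R]_n.+1) : v != 0 ->
  exists2 B, B \in unitmx & 'e_ord0 *m B = v.
Proof.
move=> v0; have rk : \rank v = 1%N by apply/eqP; rewrite rank_rV v0.
pose c := col_ebase v 0 0.
have cE : col_ebase v = c%:M by exact: mx11_scalar.
have c0 : c \is a GRing.unit.
  by have := col_ebase_unit v; rewrite cE unitmxE det_scalar1.
exists (c *: row_ebase v); first by rewrite unitmxZ // row_ebase_unit.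
rewrite -[RHS]mulmx_ebase rk cE -mulmxA mul_scalar_mx -scalemxAr; congr (_ *: (_ *m _)).
apply/rowP => i; rewrite !mxE !eqxx /=.
by case: i => [[|i] hi].
Qed.

Lemma has_jacobian_comp_affine n m (f : 'rV[R]_n -> 'rV[R]_m) (B : 'M[R]_n) z x A :
  B \in unitmx ->
  has_jacobian (fun y => f (z + y *m B)) x A ->
  has_jacobian f (z + x *m B) (invmx B *m A).
Proof.
move=> Bu hA eps eps0.
pose c := n%:R * `|invmx B| + 1.
have c0 : 0 < c by rewrite ltr_pwDr // mulr_ge0.
have hc (y : 'rV[R]_n) : `|y *m invmx B| <= c * `|y|.
  apply: le_trans (norm_mulmx _ _) _; rewrite mulrAC ler_wpM2r //.
  by rewrite /c lerDl.
have [d d0 hd] := hA (eps / c) (divr_gt0 eps0 c0).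
exists (d / c); first by rewrite divr_gt0.
move=> y; set w := z + _ => hy; set h := (y - w) *m invmx B.
have yE : y = z + (x + h) *m B.
  by rewrite mulmxDl /h mulmxKV // addrA -/w addrC subrK.
have hn : `|h| <= c * `|y - w| by exact: hc.
have := hd (x + h); rewrite [x + h - x]addrC addKr -yE mulmxA -/h -/w => hf.
apply: le_trans (hf _) _; first by apply: le_lt_trans hn _; rewrite mulrC -ltr_pdivlMr.
have e0 : 0 <= eps / c by rewrite divr_ge0 // ltW.
by apply: le_trans (ler_wpM2l e0 hn) _; rewrite mulrA divfK ?gt_eqF.
Qed.

(** After a linear change of variables the segment is an edge of a column of small cubes. Their mean
    gradients along it telescope to the increment up to face errors, so if the conclusion failed,
    one cube would have mean gradient below [c1 < c]. [exists_jacobian] then finds a contradicting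
    Jacobian inside that cube. *)
Lemma mean_value n m (f : 'rV[R]_n -> 'rV[R]_m) (L : R) x0 r (p : 'rV[R]_m) c z v :
  (forall x y, `|f x - f y| <= L * `|x - y|) -> 0 <= L ->
  (forall w A, `|w - x0| < r -> has_jacobian f w A -> c <= dot (v *m A) p) ->
  v != 0 -> `|z - x0| < r -> `|z + v - x0| < r ->
  c <= dot (f (z + v) - f z) p.
Proof.
case: n f x0 z v => [|n] f x0 z v f_lip L0 hw v0.
  by move: v0; rewrite thinmx0 eqxx.
move=> hz hzv; rewrite leNgt; apply/negP => hlt.
have [B Bu Bv] := unitmx_with_row v0.
pose G y := f (z + y *m B).
pose LG := L * (n.+1%:R * `|B|).
have LG0 : 0 <= LG by rewrite !mulr_ge0.
have G_lip x y : `|G x - G y| <= LG * `|x - y|.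
  apply: le_trans (f_lip _ _) _; rewrite /LG -mulrA ler_wpM2l //.
  rewrite opprD addrACA subrr add0r -mulmxBl.
  by apply: le_trans (norm_mulmx _ _) _; rewrite mulrAC.
set D := dot _ p in hlt.
pose c1 := (D + c) / 2.
have c1c : c1 < c by rewrite /c1; lra.
have Dc1 : D < c1 by rewrite /c1; lra.
pose P := \sum_k `|p 0 k| * (2 * LG) + 1.
have P0 : 0 < P by rewrite ltr_pwDr // sumr_ge0 // => k _; rewrite !mulr_ge0.
pose nB := n.+1%:R * `|B| + 1.
have nB0 : 0 < nB by rewrite ltr_pwDr // mulr_ge0.
pose rr := r - Num.max `|z - x0| `|z + v - x0|.
have rr0 : 0 < rr by rewrite subr_gt0 gt_max hz hzv.
(* The first bound keeps the error of the telescoping sum within [c1 - D]; the second makes a point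
   of the column stray at most [rr / 2] from the segment, hence stay in the ball. *)
pose del := Num.min ((c1 - D) / P) (rr / (2 * nB)).
have q0 : 0 < 2 * nB by apply: mulr_gt0.
have del0 : 0 < del.
  by rewrite lt_min; apply/andP; split; apply: divr_gt0 => //; rewrite subr_gt0.
have [j hj] := exists_side_le del0.
move: hj; rewrite le_min (ler_pdivlMr _ _ P0) (ler_pdivlMr _ _ q0) => /andP[hj1 hj2].
have s0 := side_gt0 R j.
pose T := (2 ^ j)%N.
have Ts : T%:R * side R j = 1 by rewrite /T natrX /side exprVn divff // expf_neq0.
pose a (k : 'I_n.+1 * 'I_m) := (k.1 == ord0)%:R * p 0 k.2.
pose Q t : cube R n.+1 := (j, 0 + (t%:R * side R j) *: 'e_ord0).
have aE (A : 'I_n.+1 * 'I_m -> R) : \sum_k a k * A k = \sum_k p 0 k * A (ord0, k).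
  rewrite (eq_bigr (fun q => a (q.1, q.2) * A (q.1, q.2))); last by case.
  rewrite -(pair_bigA _ (fun i k => a (i, k) * A (i, k))) /=.
  rewrite (bigD1 ord0) //= [X in _ + X]big1 ?addr0.
    by apply: eq_bigr => k _; rewrite /a /= mul1r.
  by move=> i /negbTE i0; apply: big1 => k _; rewrite /a /= i0 !mul0r.
have [t tT ht] : exists2 t, (t < T)%N & \sum_k a k * coord_grad G k (Q t) < c1.
  apply: contrapT => hn.
  have hge t : (t < T)%N -> c1 <= \sum_k p 0 k * coord_grad G (ord0, k) (Q t).
    move=> tT; rewrite leNgt; apply/negP => h; apply: hn; exists t => //.
    by rewrite aE.
  have : c1 <= side R j * \sum_(t < T) \sum_k p 0 k * coord_grad G (ord0, k) (Q t).
    rewrite -[c1]mulr1 -Ts mulrA mulrC ler_pM2l // mulr_natr.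
    rewrite -[T in _ *+ T](card_ord T) -sumr_const; apply: ler_sum => t _; exact: hge.
  rewrite exchange_big /= mulr_sumr leNgt => /negP; apply.
  apply: (@lt_le_trans _ _ (D + P * side R j)); last by rewrite mulrC; lra.
  have -> : D = \sum_k p 0 k * (G 'e_ord0 0 k - G 0 0 k).
    rewrite /D /dot; apply: eq_bigr => k _.
    by rewrite !mxE mulrC /G Bv mul0mx addr0.
  rewrite /P mulrDl mul1r mulr_suml addrA -big_split /=.
  apply: (@le_lt_trans _ _ (\sum_k (p 0 k * (G 'e_ord0 0 k - G 0 0 k) +
      `|p 0 k| * (2 * LG) * side R j))); last by rewrite ltrDl.
  apply: ler_sum => k _.
  rewrite -mulr_sumr mulrCA /coord_grad mean_grad_telescope Ts scale1r add0r.
  have glip := fun x y => coord_lip G_lip k x y.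
  have h1 := face_mean_near glip LG0 ord0 (j, 'e_ord0).
  have h2 := face_mean_near glip LG0 ord0 (j, 0).
  rewrite -lerBlDl -mulrBr; apply: le_trans (ler_norm _) _.
  rewrite normrM -mulrA ler_wpM2l //.
  move: h1 h2; rewrite !ler_norml /= => /andP[? ?] /andP[? ?].
  by apply/andP; split; lra.
have [x [A [hA hx hc]]] := exists_jacobian G_lip LG0 ht.
have := hw (z + x *m B) (invmx B *m A).
rewrite leNgt => /(_ _ (has_jacobian_comp_affine Bu hA))/negP; apply; last first.
  rewrite mulmxA -Bv mulmxK //; apply: le_lt_trans c1c; apply: le_trans hc.
  rewrite (aE (fun k => A k.1 k.2)) /dot; apply: ler_sum => k _.
  by rewrite -rowE mxE mulrC.
pose tau := t%:R * side R j.
have tau0 : 0 <= tau by rewrite mulr_ge0 // ltW.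
have tau1 : tau <= 1 by rewrite -Ts ler_pM2r // ler_nat ltnW.
pose u := x - tau *: 'e_ord0.
have hu : `|u| <= side R j.
  apply: mx_norm_le; first exact: ltW.
  move=> o i; rewrite ord1 !mxE; have [] := hx i; rewrite /Q /= !mxE add0r -/tau.
  by rewrite ler_norml => h1 h2; apply/andP; split; lra.
have -> : z + x *m B - x0 = (1 - tau) *: (z - x0) + tau *: (z + v - x0) + u *m B.
  rewrite /u mulmxBl -scalemxAl Bv.
  by apply/rowP => i; rewrite !mxE; ring.
apply: le_lt_trans (ler_normD _ _) _.
have h1 : `|(1 - tau) *: (z - x0) + tau *: (z + v - x0)| <= r - rr.
  have m1 : `|z - x0| <= r - rr by rewrite /rr subKr le_max lexx.
  have m2 : `|z + v - x0| <= r - rr by rewrite /rr subKr le_max lexx orbT.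
  have t1 : 0 <= 1 - tau by rewrite subr_ge0.
  apply: le_trans (ler_normD _ _) _; rewrite normrZ (normrZ tau) (ger0_norm t1) (ger0_norm tau0).
  apply: le_trans (lerD (ler_wpM2l t1 m1) (ler_wpM2l tau0 m2)) _.
  by rewrite -mulrDl subrK mul1r.
have h2 : `|u *m B| <= rr / 2.
  apply: le_trans (norm_mulmx _ _) _.
  have : n.+1%:R * `|u| * `|B| <= side R j * (n.+1%:R * `|B|).
    by rewrite mulrAC mulrC ler_wpM2r // mulr_ge0.
  have : side R j * (n.+1%:R * `|B|) <= side R j * nB by rewrite ler_pM2l // /nB lerDl.
  by move: hj2; lra.
by apply: le_lt_trans (lerD h1 h2) _; lra.
Qed.

End MeanValue.

(** * The Clarke differential *)

Section FrechetDerivative.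
Variables (R : realType) (V W : normedModType R).

Lemma frechet_diff (f : V -> W) (df : {linear V -> W}) x : continuous df ->
  (forall e, 0 < e -> exists2 d, 0 < d &
     forall y, `|y - x| < d -> `|f y - f x - df (y - x)| <= e * `|y - x|) ->
  differentiable f x /\ 'd f x = df :> (V -> W).
Proof.
move=> cdf hdf.
have o : f \o shift x = cst (f x) + df +o_ 0 id.
  apply/eqaddoP => e /hdf [d d0 hd]; apply/nbhs_norm0P; exists d => // h hh.
  by have := hd (h + x); rewrite addrK => /(_ hh); rewrite /= opprD addrA.
have dE := diff_unique cdf o.
by split=> //; apply/diff_locallyP; rewrite dE.
Qed.

Lemma diff_frechet (f : V -> W) x : differentiable f x ->
  forall e, 0 < e -> exists2 d, 0 < d &
    forall y, `|y - x| < d -> `|f y - f x - 'd f x (y - x)| <= e * `|y - x|.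
Proof.
move=> /diff_locally/eqaddoP h e /h/nbhs_norm0P [d /= d0 hd].
exists d => // y hy; rewrite -{1}(subrK x y) -addrA -opprD; exact: hd.
Qed.

End FrechetDerivative.

Section Jacobian.
Variables (R : realType) (n m : nat).
Implicit Types (f : 'rV[R]_n -> 'rV[R]_m) (A : 'M[R]_(n, m)).

Lemma has_jacobianP f x A :
  has_jacobian f x A <-> differentiable f x /\ 'J f x = A.
Proof.
split=> [hA|[df <-]].
  have cA : continuous (mulmxr A : {linear 'rV[R]_n -> 'rV[R]_m}).
    apply: bounded_linear_continuous; exists (n%:R * `|A|); split; first exact: num_real.
    move=> M hM; have := @nbhs0_lt R 'rV[R]_n 1 ltr01.
    apply: filterS => v v1; apply: le_trans (ltW hM).
    apply: le_trans (norm_mulmx _ _) _; rewrite mulrAC.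
    by rewrite ler_piMr ?(ltW v1) // mulr_ge0.
  have [df dE] := frechet_diff cA hA.
  by split=> //; apply/row_matrixP => i; rewrite !rowE /jacobian mul_rV_lin1 dE.
move=> e /(diff_frechet df) [d d0 hd]; exists d => // y /hd.
by rewrite /jacobian mul_rV_lin1.
Qed.

Lemma has_jacobian_bound f (L : R) x A : 0 <= L ->
  (forall x y, `|f x - f y| <= L * `|x - y|) ->
  has_jacobian f x A -> forall v : 'rV[R]_n, `|v *m A| <= L * `|v|.
Proof.
move=> L0 f_lip hA v; have [->|v0] := eqVneq v 0.
  by rewrite mul0mx !normr0 mulr0.
have nv : 0 < `|v| by rewrite normr_gt0.
apply/ler_addgt0Pr => e e0.
have [d d0 hd] := hA (e / `|v|) (divr_gt0 e0 nv).
pose s := d / (2 * `|v|).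
have s0 : 0 < s by rewrite divr_gt0 // mulr_gt0.
have sn : `|s *: v| = s * `|v| by rewrite normrZ gtr0_norm.
have := hd (x + s *: v); rewrite [x + _ - x]addrC addKr sn.
have -> : s * `|v| < d.
  by rewrite /s invfM mulrA mulfVK ?gt_eqF // ltr_pdivrMr //; lra.
move=> /(_ isT) h; have := f_lip (x + s *: v) x; rewrite [x + _ - x]addrC addKr sn => hl.
have : `|(s *: v) *m A| <= s * (L * `|v| + e).
  rewrite -[_ *m A](subKr (f (x + s *: v) - f x)).
  apply: le_trans (ler_normB _ _) _; apply: le_trans (lerD hl h) _.
  have -> : e / `|v| * (s * `|v|) = s * e by rewrite mulrCA divfK ?gt_eqF.
  by rewrite mulrDr mulrCA.
by rewrite -scalemxAl normrZ gtr0_norm // ler_pM2l.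
Qed.

Lemma norm_jacobian_le f (L : R) x : 0 <= L ->
  (forall x y, `|f x - f y| <= L * `|x - y|) ->
  differentiable f x -> `|'J f x| <= L.
Proof.
move=> L0 f_lip df; apply: mx_norm_le => // i k.
have hA : has_jacobian f x ('J f x) by apply/has_jacobianP.
have := has_jacobian_bound L0 f_lip hA 'e_i.
have -> : `|'e_i : 'rV[R]_n| = 1.
  apply/eqP; rewrite eq_le; apply/andP; split.
    by apply: mx_norm_le => // a b; rewrite mxE; case: (_ && _); rewrite ?normr1 ?normr0.
  by apply: le_trans (mx_entry_le_norm _ 0 i); rewrite mxE !eqxx normr1.
rewrite mulr1; apply: le_trans.
by have := mx_entry_le_norm (row i ('J f x)) 0 k; rewrite [row _ _ _ _]mxE -rowE.
Qed.

Lemma compact_mx_ball (B : R) : compact [set A : 'M[R]_(n, m) | `|A| <= B].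
Proof.
have -> : [set A : 'M[R]_(n, m) | `|A| <= B] = vec_mx @` [set v : 'rV[R]_(n * m) | `|v| <= B].
  apply/seteqP; split=> [A /= hA|_ [v /= hv <-]].
    exists (mxvec A); last exact: mxvecK.
    apply: mx_norm_le => [|o k]; first exact: le_trans hA.
    rewrite ord1; case/mxvec_indexP: k => i j; rewrite mxvecE.
    exact: le_trans (mx_entry_le_norm _ _ _) hA.
  apply: mx_norm_le => [|i j]; first exact: le_trans hv.
  by rewrite mxE; exact: le_trans (mx_entry_le_norm _ _ _) hv.
apply: continuous_compact.
  apply: continuous_subspaceT.
  apply: (@bounded_linear_continuous _ _ _ (vec_mx : {linear 'rV[R]_(n * m) -> 'M[R]_(n, m)})).
  exists 1; split=> // M hM; have := @nbhs0_lt R 'rV[R]_(n * m) 1 ltr01.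
  apply: filterS => v v1; apply: le_trans (ltW hM); apply: le_trans (ltW v1).
  by apply: mx_norm_le => // i j; rewrite mxE; exact: mx_entry_le_norm.
apply: bounded_closed_compact.
  by exists B; split; [exact: num_real | move=> M BM v /= hv; exact: le_trans hv (ltW BM)].
rewrite (_ : [set v | _] = (fun v : 'rV[R]_(n * m) => `|v|) @^-1` [set r | r <= B]) //.
by apply: closed_comp => [v _|]; [exact: norm_continuous | exact: closed_le].
Qed.

End Jacobian.

Section LimitingJacobian.
Variables (R : realType) (n : nat) (f : 'rV[R]_n -> 'rV[R]_n) (L : R).
Hypothesis f_lip : forall x y, `|f x - f y| <= L * `|x - y|.
Hypothesis L_ge0 : 0 <= L.

Lemma limiting_jacobianP x A :
  limiting_jacobian f x A <->
  forall e, 0 < e -> exists w, [/\ `|w - x| < e, differentiable f w & `|'J f w - A| < e].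
Proof.
split=> [[u [ux du uA]] e e0|h].
  have [N1 _ h1] : \forall i \near \oo, `|u i - x| < e.
    by move/cvgr_distC_lt: ux; apply.
  have [N2 _ h2] : \forall i \near \oo, `|'J f (u i) - A| < e.
    by move/cvgr_distC_lt: uA; apply.
  exists (u (N1 + N2)%N); split => //; first by apply: h1; rewrite /= leq_addr.
  by apply: h2; rewrite /= leq_addl.
have hk k : exists w, [/\ `|w - x| < side R k, differentiable f w &
    `|'J f w - A| < side R k] by apply: h; exact: side_gt0.
have [u hu] := choice hk.
have small e : 0 < e -> \forall i \near \oo, side R i < e.
  move=> e0; have /cvgrPdist_lt /(_ e e0) := @cvg_side R; apply: filterS => i.
  by rewrite sub0r normrN gtr0_norm // side_gt0.
exists u; split.
- apply/cvgrPdist_lt => e /small; apply: filterS => i; apply: lt_trans.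
  by rewrite distrC; have [] := hu i.
- by move=> i; have [] := hu i.
- apply/cvgrPdist_lt => e /small; apply: filterS => i; apply: lt_trans.
  by rewrite distrC; have [] := hu i.
Qed.

Lemma limiting_jacobian_closed x A :
  (forall e, 0 < e -> exists2 B, limiting_jacobian f x B & `|B - A| < e) ->
  limiting_jacobian f x A.
Proof.
move=> h; apply/limiting_jacobianP => e e0.
have e2 : 0 < e / 2 by rewrite divr_gt0.
have [B /limiting_jacobianP hB BA] := h _ e2.
have [w [w1 dw w2]] := hB _ e2.
exists w; split => //; first by lra.
rewrite -(subrKA B); apply: le_lt_trans (ler_normD _ _) _; lra.
Qed.

Lemma norm_limiting_jacobian_le x A : limiting_jacobian f x A -> `|A| <= L.
Proof.
move=> /limiting_jacobianP h; apply/ler_addgt0Pr => e e0.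
have [w [_ dw hw]] := h e e0; have := norm_jacobian_le L_ge0 f_lip dw.
have := ler_distD ('J f w) A 0; rewrite !subr0 distrC; lra.
Qed.

(** Upper semicontinuity by compactness: Jacobians at points tending to [x] are bounded by [L], and
    any cluster point of them is a limiting Jacobian. *)
Lemma jacobian_near_limiting x delta : 0 < delta ->
  exists2 r, 0 < r & forall w, `|w - x| < r -> differentiable f w ->
    exists2 A, limiting_jacobian f x A & `|'J f w - A| < delta.
Proof.
move=> d0; apply: contrapT => hn.
have hk k : exists w, [/\ `|w - x| < side R k, differentiable f w &
    forall A, limiting_jacobian f x A -> delta <= `|'J f w - A|].
  apply: contrapT => hk; apply: hn; exists (side R k); first exact: side_gt0.
  move=> w hw dw; apply: contrapT => hA; apply: hk; exists w; split => // A limA.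
  by rewrite leNgt; apply/negP => hlt; apply: hA; exists A.
have [u hu] := choice hk.
have := @compact_mx_ball R n n L ((fun k => 'J f (u k)) @ \oo).
case => [|A [_ cA]].
  exists 0%N => // k _ /=; apply: (norm_jacobian_le L_ge0 f_lip); by have [] := hu k.
have limA e : 0 < e -> exists k, side R k < e /\ `|'J f (u k) - A| < e.
  move=> e0; have [s hs] := exists_side_le (divr_gt0 e0 (ltr0Sn R 1)).
  have [||_ [[k sk <-] hB]] := cA ((fun k => 'J f (u k)) @` [set k | (s <= k)%N]) (ball A e).
  - by exists s => // k /= sk; exists k.
  - exact: nbhsx_ballx.
  exists k; split; first by have := side_le R sk; lra.
  by move: hB; rewrite -ball_normE /= distrC.
have : limiting_jacobian f x A.
  apply/limiting_jacobianP => e /limA [k [ke hA]]; exists (u k).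
  by have [h1 h2 _] := hu k; split => //; exact: lt_trans h1 ke.
have [k [_ hA]] := limA delta d0.
by move=> /(let: And3 _ _ h := hu k in h A); rewrite leNgt hA.
Qed.

End LimitingJacobian.

(** * Carathéodory's theorem for matrices *)

Section ConvexCombinations.
Variables (R : realType) (n m : nat) (S : set 'M[R]_(n, m)).

Definition convex_comb (k : nat) (A : 'M[R]_(n, m)) : Prop :=
  exists (w : 'I_k -> R) (s : 'I_k -> 'M[R]_(n, m)),
    [/\ forall i, 0 <= w i, \sum_i w i = 1, forall i, S (s i) &
      A = \sum_i w i *: s i].

Lemma convex_comb_pad k A : convex_comb k A -> convex_comb k.+1 A.
Proof.
case: k => [|k] [w [s [w0 w1 Ss ->]]].
  by move: w1; rewrite big_ord0 => /eqP; rewrite eq_sym oner_eq0.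
exists (fun i => oapp w 0 (unlift ord0 i)), (fun i => oapp s (s ord0) (unlift ord0 i)).
split=> [i||i|].
- by case: (unlift ord0 i) => //=.
- rewrite big_ord_recl unlift_none /= add0r -w1.
  by apply: eq_bigr => i _; rewrite liftK.
- by case: (unlift ord0 i) => //=.
- rewrite [RHS]big_ord_recl unlift_none /= scale0r add0r.
  by apply: eq_bigr => i _; rewrite liftK.
Qed.

Lemma affine_dependence k (s : 'I_k -> 'M[R]_(n, m)) : ((n * m).+1 < k)%N ->
  exists l : 'I_k -> R, [/\ \sum_i l i = 0, \sum_i l i *: s i = 0 & exists i, 0 < l i].
Proof.
(* The appended entry 1 makes a vector of the left kernel a linear relation whose coefficients also
   sum to zero. *)
move=> hk; pose D : 'M[R]_(k, n * m + 1) := \matrix_i row_mx (mxvec (s i)) 1.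
have : kermx D != 0.
  rewrite -mxrank_eq0 mxrank_ker subn_eq0 -ltnNge.
  by apply: leq_ltn_trans (rank_leq_col _) _; rewrite addn1.
case/rowV0Pn => v /sub_kermxP vD v0.
have vD' : \sum_i v 0 i *: row_mx (mxvec (s i)) 1 = 0 :> 'rV[R]_(n * m + 1).
  rewrite -[RHS]vD [RHS]mulmx_sum_row; apply: eq_bigr => i _; by rewrite rowK.
have e1 : \sum_i v 0 i = 0.
  have := congr1 (@rsubmx _ 1 (n * m) 1) vD'; rewrite linear_sum linear0.
  move=> /matrixP/(_ 0 0); rewrite summxE [X in _ = X]mxE => h; rewrite -[RHS]h.
  by apply: eq_bigr => i _; rewrite linearZ /= row_mxKr !mxE mulr1.
have e2 : \sum_i v 0 i *: s i = 0.
  have := congr1 (@lsubmx _ 1 (n * m) 1) vD'; rewrite linear_sum linear0.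
  move=> /(congr1 vec_mx); rewrite linear_sum linear0 => h; rewrite -[RHS]h.
  by apply: eq_bigr => i _; rewrite !linearZ /= row_mxKl mxvecK.
exists (v 0); split=> //; apply: contrapT => hn.
have v_le i : v 0 i <= 0 by rewrite leNgt; apply/negP => h; apply: hn; exists i.
move/eqP: v0; apply; apply/rowP => i; rewrite mxE; apply/eqP.
have : \sum_i - v 0 i == 0 by rewrite sumrN e1 oppr0.
rewrite psumr_eq0 => [/allP/(_ i)|j _]; last by rewrite oppr_ge0.
by rewrite mem_index_enum oppr_eq0 => /(_ isT).
Qed.

(** Subtracting the multiple of an affine dependence with the smallest ratio [w i / l i] over
    positive [l i] keeps all weights nonnegative and makes one of them vanish. *)
Lemma convex_comb_reduce k A : ((n * m).+1 < k.+1)%N ->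
  convex_comb k.+1 A -> convex_comb k A.
Proof.
move=> hk [w [s [w0 w1 Ss ->]]].
have [l [l1 ls [i1 li1]]] := affine_dependence s hk.
case: (@Order.TotalTheory.arg_minP _ _ _ i1 (fun i => 0 < l i) (fun i => w i / l i) li1)
  => i0 li0 hmin.
pose a := w i0 / l i0.
have a0 : 0 <= a by rewrite divr_ge0 // ltW.
pose w' i := w i - a * l i.
have w'0 i : 0 <= w' i.
  rewrite subr_ge0; case: (ltrP 0 (l i)) => h; last first.
    by apply: le_trans (w0 i); rewrite mulr_ge0_le0.
  by rewrite -ler_pdivlMr //; exact: hmin.
have w'i0 : w' i0 = 0 by rewrite /w' /a divfK ?gt_eqF // subrr.
exists (fun i => w' (lift i0 i)), (fun i => s (lift i0 i)); split=> //.
- transitivity (\sum_i w' i); first by rewrite (bigD1_ord i0) //= w'i0 add0r.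
  by rewrite /w' sumrB -mulr_sumr l1 mulr0 subr0.
- transitivity (\sum_i w' i *: s i); last first.
    by rewrite (bigD1_ord i0) //= w'i0 scale0r add0r.
  rewrite /w'; under [RHS]eq_bigr do rewrite scalerBl -scalerA.
  by rewrite sumrB -scaler_sumr ls scaler0 subr0.
Qed.

Let N := (n * m).+1.

(** A length independent of [A] makes the [N]-term combinations a convex set and lets limits be
    taken term by term in [hull_lower_bound]. *)
Lemma convex_comb_caratheodory k A : convex_comb k A -> convex_comb N A.
Proof.
case: (leqP k N) => hk.
  rewrite -(subnKC hk); elim: (N - k)%N => [|d IH] /=; rewrite ?addn0 // addnS.
  by move=> /IH /convex_comb_pad.
rewrite -(subnKC (ltnW hk)); elim: (k - N)%N => [|d IH]; rewrite ?addn0 // addnS => h.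
apply: IH; apply: convex_comb_reduce h; by rewrite ltnS leq_addr.
Qed.

Lemma convex_comb_mix k k' A B (p : R) : 0 <= p -> p <= 1 ->
  convex_comb k A -> convex_comb k' B -> convex_comb (k + k') (p *: A + (1 - p) *: B).
Proof.
move=> p0 p1 [w [s [w0 w1 Ss ->]]] [w' [s' [w'0 w'1 Ss' ->]]].
have q0 : 0 <= 1 - p by rewrite subr_ge0.
exists (fun i : 'I_(k + k') =>
    match fintype.split i with inl j => p * w j | inr j => (1 - p) * w' j end),
  (fun i : 'I_(k + k') => match fintype.split i with inl j => s j | inr j => s' j end).
have sl (j : 'I_k) : fintype.split (lshift k' j) = inl j by exact: (unsplitK (inl j)).
have sr (j : 'I_k') : fintype.split (rshift k j) = inr j by exact: (unsplitK (inr j)).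
split=> [i||i|].
- by case: (fintype.split i) => j; rewrite mulr_ge0.
- rewrite big_split_ord /=; under eq_bigr do rewrite sl.
  under [X in _ + X]eq_bigr do rewrite sr.
  by rewrite -!mulr_sumr w1 w'1 !mulr1 addrC subrK.
- by case: (fintype.split i).
- rewrite [RHS]big_split_ord /= !scaler_sumr.
  by congr (_ + _); apply: eq_bigr => i _; rewrite ?sl ?sr scalerA.
Qed.

Lemma convex_hull_comb A : convex_hull S A -> convex_comb N A.
Proof.
apply: smallest_sub => [|B SB].
  move=> B C lam; rewrite !inE => hB hC.
  apply: convex_comb_caratheodory; apply: convex_comb_mix hB hC => //.
apply: (@convex_comb_caratheodory 1).
by exists (fun=> 1), (fun=> B); split => //; rewrite big_ord1 ?scale1r.
Qed.

Lemma convex_comb_in k (C : set 'M[R]_(n, m)) A :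
  convex_set (C : set (convex_lmodType 'M[R]_(n, m))) -> S `<=` C ->
  convex_comb k A -> C A.
Proof.
move=> cC SC; elim: k A => [|k IH] A [w [s [w0 w1 Ss ->]]].
  by move: w1; rewrite big_ord0 => /eqP; rewrite eq_sym oner_eq0.
rewrite big_ord_recl; rewrite big_ord_recl in w1.
have [w01|w01] := eqVneq (w ord0) 1.
  have : \sum_(i < k) w (lift ord0 i) == 0 by rewrite w01 in w1; apply/eqP; lra.
  rewrite psumr_eq0 => // /allP h.
  rewrite w01 scale1r big1 ?addr0; first by apply: SC.
  by move=> i _; have /eqP -> := h i (mem_index_enum _); rewrite scale0r.
have r0 : 0 <= \sum_(i < k) w (lift ord0 i) by apply: sumr_ge0.
have w0le : w ord0 <= 1 by lra.
have q0 : 0 < 1 - w ord0 by rewrite subr_gt0 lt_neqAle w01.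
pose B := \sum_(i < k) (w (lift ord0 i) / (1 - w ord0)) *: s (lift ord0 i).
have CB : C B.
  apply: IH; exists (fun i => w (lift ord0 i) / (1 - w ord0)), (fun i => s (lift ord0 i)).
  split=> // [i|]; first by rewrite divr_ge0 // ltW.
  by rewrite -mulr_suml (_ : \sum_i _ = 1 - w ord0) ?divff ?gt_eqF //; lra.
have := cC (s ord0) B (Itv01 (w0 ord0) w0le).
rewrite !inE => /(_ (SC _ (Ss _)) CB).
congr (C _).
change (w ord0 *: s ord0 + (1 - w ord0) *: B =
  w ord0 *: s ord0 + \sum_(i < k) w (lift ord0 i) *: s (lift ord0 i)).
congr (_ + _); rewrite /B scaler_sumr; apply: eq_bigr => i _.
by rewrite scalerA mulrC divfK ?gt_eqF.
Qed.

Lemma convex_comb_hull k A : convex_comb k A -> convex_hull S A.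
Proof. by move=> h C [cC SC]; exact: convex_comb_in cC SC h. Qed.

End ConvexCombinations.

(** * Resolvent bounds *)

Section DetLowerBound.
Variable R : realType.

Lemma horner_char_poly (F : comNzRingType) n (A : 'M[F]_n) t :
  (char_poly A).[t] = \det (t%:M - A).
Proof.
rewrite -horner_evalE -det_map_mx; congr (\det _); apply/matrixP => i j.
by rewrite !mxE /= horner_evalE !hornerE hornerMn hornerX.
Qed.

(** The determinant is the product of t - z over the complex roots z of the characteristic
    polynomial, and each factor has modulus at least t because Re z < 0 <= t. *)
Lemma det_lower_bound n (A : 'M[R]_n) (t : R) : 0 <= t ->
  (forall z, eigenvalue (map_mx (real_complex R) A) z -> complex.Re z < 0) ->
  t ^+ n <= `|\det (t%:M - A)|.
Proof.
move=> t0 hA; set Ac := map_mx _ A in hA.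
have [rs hrs] := closed_field_poly_normal (char_poly Ac).
rewrite (monicP (char_poly_monic Ac)) scale1r in hrs.
have szrs : size rs = n.
  have := size_char_poly Ac; rewrite hrs size_prod_XsubC => -[] //.
have hz z : z \in rs -> complex.Re z < 0.
  by move=> zr; apply: hA; rewrite eigenvalue_root_char hrs root_prod_XsubC.
have detE : real_complex R (\det (t%:M - A)) = \prod_(z <- rs) (real_complex R t - z).
  rewrite -det_map_mx map_mxB map_scalar_mx -/Ac -horner_char_poly hrs horner_prod.
  by apply: eq_bigr => z _; rewrite hornerXsubC.
have hprod : t ^+ size rs <= Normc.normc (\prod_(z <- rs) (real_complex R t - z)).
  elim: rs hz {hrs szrs detE} => [|z rs IH] hz; first by rewrite big_nil Normc.normc1.
  rewrite big_cons Normc.normcM exprS; apply: ler_pM => //.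
  - by rewrite exprn_ge0.
  - have := hz z (mem_head _ _); case: z {hz} => a b /= a0.
    rewrite -[leLHS]ger0_norm // -[leLHS]sqrtr_sqr ler_sqrt; last first.
      by rewrite addr_ge0 ?sqr_ge0.
    have : 0 <= (0 - b) ^+ 2 by exact: sqr_ge0.
    by nra.
  - by apply: IH => w hw; apply: hz; rewrite in_cons hw orbT.
move: hprod; rewrite -detE szrs /= expr0n addr0 sqrtr_sqr.
by [].
Qed.

Lemma norm_det_le n (B : 'M[R]_n) b : (forall i j, `|B i j| <= b) ->
  `|\det B| <= #|{perm 'I_n}|%:R * b ^+ n.
Proof.
move=> hB; rewrite /determinant; apply: le_trans (ler_norm_sum _ _ _) _.
rewrite mulr_natl -sumr_const; apply: ler_sum => s _.
rewrite normrM normrX normrN1 expr1n mul1r normr_prod.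
rewrite -[n in b ^+ n](card_ord n) -prodr_const; apply: ler_prod => i _.
by rewrite normr_ge0 hB.
Qed.

(** Multiplying [v *m B] by the adjugate gives [\det B *: v], and the entries of the adjugate are
    bounded by those of [B]. *)
Lemma mulmx_lower_bound n (B : 'M[R]_n) b d (v : 'rV[R]_n) :
  `|B| <= b -> d <= `|\det B| ->
  d * `|v| <= n%:R * (#|{perm 'I_n.-1}|%:R * b ^+ n.-1) * `|v *m B|.
Proof.
move=> hB hd; have b0 : 0 <= b by exact: le_trans hB.
have hadj : `|\adj B| <= #|{perm 'I_n.-1}|%:R * b ^+ n.-1.
  apply: mx_norm_le => [|i j]; first by rewrite mulr_ge0 // exprn_ge0.
  rewrite mxE /cofactor normrM normrX normrN1 expr1n mul1r.
  by apply: norm_det_le => k l; rewrite !mxE; exact: le_trans (mx_entry_le_norm _ _ _) hB.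
have e : (v *m B) *m \adj B = \det B *: v by rewrite -mulmxA mul_mx_adj mul_mx_scalar.
apply: (@le_trans _ _ (`|\det B| * `|v|)); first by rewrite ler_wpM2r.
rewrite -normrZ -e; apply: le_trans (norm_mulmx _ _) _.
by rewrite mulrAC ler_wpM2r // ler_wpM2l.
Qed.

Lemma resolvent_lower_bound n (b t0 t1 : R) : 0 < t0 -> exists2 c, 0 < c &
  forall (A : 'M[R]_n) t, t0 <= t -> t <= t1 -> `|A| <= b ->
  (forall z, eigenvalue (map_mx (real_complex R) A) z -> complex.Re z < 0) ->
  forall v : 'rV[R]_n, c * `|v| <= `|v *m A - t *: v|.
Proof.
move=> t00; set C := n%:R * (#|{perm 'I_n.-1}|%:R * (t1 + b) ^+ n.-1).
exists (t0 ^+ n / (`|C| + 1)) => [|A t ht0 ht1 hb hA v].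
  by rewrite divr_gt0 ?exprn_gt0 // ltr_pwDr.
have tp : 0 <= t by apply: le_trans (ltW t00) ht0.
have hB : `|t%:M - A| <= t1 + b.
  apply: le_trans (ler_normB _ _) _; apply: lerD => //.
  have t10 : 0 <= t1 by apply: le_trans ht1.
  by apply: mx_norm_le => // i j; rewrite mxE; case: eqP => _; rewrite ?normr0 ?ger0_norm.
have hd : t0 ^+ n <= `|\det (t%:M - A)|.
  apply: le_trans (det_lower_bound tp hA); apply: lerXn2r => //.
    by rewrite nnegrE ltW.
have := mulmx_lower_bound v hB hd; rewrite -/C mulmxBr mul_mx_scalar distrC => h.
rewrite mulrAC ler_pdivrMr ?ltr_pwDr //; apply: le_trans h _.
by rewrite mulrC ler_wpM2l //; apply: le_trans (ler_norm C) _; rewrite lerDl.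
Qed.

End DetLowerBound.

(** * Uniform invertibility on a compact convex hull *)

Section HullLowerBound.
Variables (R : realType) (n : nat) (S : set 'M[R]_n) (L : R).
Hypothesis S_bounded : forall A, S A -> `|A| <= L.
Hypothesis S_closed : forall A, (forall e, 0 < e -> exists2 B, S B & `|B - A| < e) -> S A.

Lemma norm_convex_hull_le A : convex_hull S A -> `|A| <= L.
Proof.
move: A; apply: smallest_sub => // A B p; rewrite !inE /= => hA hB.
change (`|p%:num *: A + (1 - p%:num) *: B| <= L).
have p0 : 0 <= p%:num by [].
have p1 : 0 <= 1 - p%:num by rewrite subr_ge0.
apply: le_trans (ler_normD _ _) _; rewrite !normrZ (ger0_norm p0) (ger0_norm p1).
by apply: le_trans (lerD (ler_wpM2l p0 hA) (ler_wpM2l p1 hB)) _; rewrite -mulrDl addrC subrK mul1r.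
Qed.

(** With an ultrafilter, the finitely many sequences of weights, matrices and vectors below converge
    simultaneously, without extracting subsequences one after another. *)
Lemma ultra_cvg_in_compact (T : topologicalType) (U : set_system nat) (K : set T)
  (u : nat -> T) : UltraFilter U -> compact K -> (forall k, K (u k)) ->
  exists2 l, K l & u @ U --> l.
Proof.
move=> UU cK Ku.
have FK : U (u @^-1` K) by apply: (filterS _ (@filterT _ U _)) => k _; exact: Ku.
have [l [Kl cl]] := cK (u @ U) _ FK.
exists l => // B Bl; have [//|hn] := in_ultra_setVsetC (u @^-1` B) UU.
have [x []] := cl (~` B) B hn Bl; by [].
Qed.

(** Otherwise there are unit vectors and hull matrices whose products tend to 0. Limits of the [N]
    weights and of the [N] matrices give a hull matrix annihilating a unit vector. *)
Lemma hull_lower_bound : (forall A, convex_hull S A -> A \in unitmx) ->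
  exists2 c, 0 < c & forall A, convex_hull S A -> forall v : 'rV[R]_n,
    c * `|v| <= `|v *m A|.
Proof.
move=> hunit; apply: contrapT => hn.
have hk k : exists Ax : 'M[R]_n * 'rV[R]_n,
    [/\ convex_hull S Ax.1, `|Ax.2| = 1 & `|Ax.2 *m Ax.1| < side R k].
  apply: contrapT => hk; apply: hn; exists (side R k); first exact: side_gt0.
  move=> A hA v; have [->|v0] := eqVneq v 0; first by rewrite mul0mx normr0 mulr0.
  have nv : 0 < `|v| by rewrite normr_gt0.
  rewrite leNgt; apply/negP => hlt; apply: hk; exists (A, `|v|^-1 *: v); split => //=.
    by rewrite normrZ normfV normr_id mulVf // gt_eqF.
  by rewrite -scalemxAl normrZ normfV normr_id mulrC ltr_pdivrMr.
have [Ax hAx] := choice hk.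
pose N := (n * n).+1.
have hws k : exists ws : ('I_N -> R) * ('I_N -> 'M[R]_n),
    [/\ forall i, 0 <= ws.1 i, \sum_i ws.1 i = 1, forall i, S (ws.2 i) &
      (Ax k).1 = \sum_i ws.1 i *: ws.2 i].
  by have [/convex_hull_comb [w [s ?]] _ _] := hAx k; exists (w, s).
have [ws {}hws] := choice hws.
have [U [UU Uoo]] := @ultraFilterLemma nat \oo _.
have w_le k i : 0 <= (ws k).1 i <= 1.
  have [w0 <- _ _] := hws k; rewrite w0 (bigD1 i) //= lerDl.
  by apply: sumr_ge0.
have hw i : exists l, (fun k => (ws k).1 i) @ U --> (l : R).
  have Ku k : `[0, 1]%classic ((ws k).1 i) by rewrite /= in_itv /=; exact: w_le.
  have [l _ hl] := ultra_cvg_in_compact UU (@segment_compact R 0 1) Ku.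
  by exists l.
have hs i : exists l : 'M[R]_n, (fun k => (ws k).2 i) @ U --> l.
  have Ku k : `|(ws k).2 i| <= L by apply: S_bounded; have [_ _ h _] := hws k.
  have [l _ hl] := ultra_cvg_in_compact UU (@compact_mx_ball R n n L) Ku.
  by exists l.
have Kv k : `|(Ax k).2| <= 1 by have [_ -> _] := hAx k.
have [v _ hv] := ultra_cvg_in_compact UU (@compact_mx_ball R 1 n 1) Kv.
have [w {}hw] := choice hw.
have [s {}hs] := choice hs.
pose A := \sum_i w i *: s i.
have hA : (fun k => (Ax k).1) @ U --> A.
  have -> : (fun k => (Ax k).1) = (fun k => \sum_i (ws k).1 i *: (ws k).2 i).
    by apply/funext => k; have [_ _ _] := hws k.
  apply: cvg_big => //= [|i _]; first exact: add_continuous.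
  by apply: cvgZ; [exact: hw | exact: hs].
have hullA : convex_hull S A.
  apply: (@convex_comb_hull _ _ _ _ N); exists w, s; split => //.
  - move=> i; rewrite -(cvg_lim _ (hw i)) //; apply: limr_ge.
      by apply/cvg_ex; exists (w i); exact: hw.
    by apply: nearW => k; have /andP[] := w_le k i.
  - have h1 : (fun k => \sum_i (ws k).1 i) @ U --> \sum_i w i.
      by apply: cvg_big => //=; exact: add_continuous.
    have h2 : (fun k => \sum_i (ws k).1 i) @ U --> (1 : R).
      by rewrite (_ : (fun k => _) = cst 1); [exact: cvg_cst | apply/funext => k; have [] := hws k].
    exact: (cvg_unique _ h1 h2).
  - move=> i; apply: S_closed => e e0.
    have /cvgr_distC_lt /(_ e e0) h := hs i.
    have [k hk'] := filter_ex h.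
    by exists ((ws k).2 i) => //; have [_ _] := hws k.
have close e : 0 < e -> exists k, [/\ `|(Ax k).2 - v| < e, `|(Ax k).1 - A| < e & side R k < e].
  move=> e0.
  have /cvgr_distC_lt /(_ e e0) h1 := hv.
  have /cvgr_distC_lt /(_ e e0) h2 := hA.
  have h3 : \forall k \near U, side R k < e.
    have /cvgr_lt /(_ e e0) h := @cvg_side R.
    exact: (Uoo _ h).
  have [k [[k1 k2] k3]] := filter_ex (filterI (filterI h1 h2) h3).
  by exists k.
have vA0 : v *m A = 0.
  apply/eqP; rewrite -normr_le0; apply/ler_addgt0Pr => e e0; rewrite add0r.
  pose q := 1 + n%:R * `|A| + n%:R.
  have q0 : 0 < q by rewrite /q -addrA ltr_pwDl // addr_ge0 // mulr_ge0.
  have [k [k1 k2 k3]] := close (e / q) (divr_gt0 e0 q0).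
  have [_ n1 small] := hAx k.
  have -> : v *m A = (Ax k).2 *m (Ax k).1 - ((Ax k).2 - v) *m A - (Ax k).2 *m ((Ax k).1 - A).
    by rewrite mulmxBl mulmxBr; apply/rowP => i; rewrite !mxE; ring.
  apply: le_trans (ler_normB _ _) _; apply: le_trans (lerD (ler_normB _ _) (lexx _)) _.
  have b1 := norm_mulmx ((Ax k).2 - v) A; have b2 := norm_mulmx (Ax k).2 ((Ax k).1 - A).
  rewrite n1 mulr1 in b2.
  have c1 : n%:R * `|(Ax k).2 - v| * `|A| <= (n%:R * `|A|) * (e / q).
    by rewrite mulrAC ler_wpM2l ?mulr_ge0 // ltW.
  have c2 : n%:R * `|(Ax k).1 - A| <= n%:R * (e / q) by rewrite ler_wpM2l // ltW.
  have eE : e = e / q * q by rewrite divfK ?gt_eqF.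
  rewrite [leRHS]eE; move: (e / q) k3 c1 c2 => t k3 c1 c2.
  by rewrite /q !mulrDr mulr1; lra.
have v0 : v = 0 by rewrite -(mulmxK (hunit A hullA) v) vA0 mul0mx.
have [k [k1 _ _]] := close 1 ltr01.
by have [_ n1 _] := hAx k; move: k1; rewrite v0 subr0 n1 ltxx.
Qed.

End HullLowerBound.

(** * Local expansion and continuation in t *)

Section LocalExpansion.
Variables (R : realType).

(** The first-order condition at the point of least Euclidean norm, for an approximate minimizer
    since [K] need not be closed; the slack is paid by the factor 1/2. *)
Lemma near_projection n (K : set 'rV[R]_n) (a B : R) : 0 < a -> K !=set0 ->
  (forall k k' s, 0 <= s -> s <= 1 -> K k -> K k' -> K (s *: k + (1 - s) *: k')) ->
  (forall k, K k -> a <= `|k|) -> (forall k, K k -> `|k| <= B) ->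
  exists2 p, K p & forall k, K k -> dot p p / 2 <= dot k p.
Proof.
move=> a0 [k1 Kk1] cK Ka KB.
pose E := [set dot k k | k in K].
have hE : has_inf E.
  split; first by exists (dot k1 k1), k1.
  by exists 0 => _ [k _ <-]; apply: le_trans (sqr_norm_le_dot k); exact: sqr_ge0.
pose D := n%:R * (2 * B) * (2 * B).
have B0 : 0 <= B by apply: le_trans (KB _ Kk1).
have D0 : 0 <= D by rewrite !mulr_ge0.
have a2 : 0 < a ^+ 2 by rewrite exprn_gt0.
(* Moving from [p] towards [k] by [s] changes the square norm to second order by at most
   [s * (s * D)]; this [s] gives [s * D <= a ^+ 2 / 2], matching the tolerance [s * (a ^+ 2 / 2)] of
   the near minimum. *)
pose s := a ^+ 2 / (2 * (D + a ^+ 2)).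
have Da : 0 < 2 * (D + a ^+ 2) by rewrite mulr_gt0 // ltr_wpDl.
have s0 : 0 < s by rewrite divr_gt0.
have s1 : s <= 1 by rewrite ler_pdivrMr // mul1r; lra.
have sD : s * D <= a ^+ 2 / 2.
  rewrite /s mulrAC ler_pdivrMr //.
  have : 0 <= a ^+ 2 * a ^+ 2 by rewrite mulr_ge0 // ltW.
  lra.
have eta0 : 0 < s * (a ^+ 2 / 2) by rewrite mulr_gt0 // divr_gt0.
have [_ [p Kp <-] hp] := inf_adherent eta0 hE.
exists p => // k Kk.
have m1 : inf E <= dot (s *: k + (1 - s) *: p) (s *: k + (1 - s) *: p).
  apply: ge_inf; first exact: hE.2.
  by exists (s *: k + (1 - s) *: p) => //; apply: cK => //; exact: ltW.
have e : dot (s *: k + (1 - s) *: p) (s *: k + (1 - s) *: p) =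
    dot p p + 2 * s * (dot k p - dot p p) + s * (s * dot (k - p) (k - p)).
  have -> : s *: k + (1 - s) *: p = p + s *: (k - p).
    by apply/rowP => i; rewrite !mxE; ring.
  rewrite !(dotBl, dotBr, dotDl, dotDr, dotZl, dotZr) (dotC p k); ring.
have kp : dot (k - p) (k - p) <= D.
  apply: le_trans (ler_norm _) _; apply: le_trans (norm_dot _ _) _.
  have h : `|k - p| <= 2 * B.
    by apply: le_trans (ler_normB _ _) _; have := KB _ Kk; have := KB _ Kp; lra.
  rewrite /D ler_pM ?mulr_ge0 //; by rewrite ler_wpM2l.
have pp : a ^+ 2 <= dot p p.
  apply: le_trans (sqr_norm_le_dot p); rewrite lerXn2r ?nnegrE ?(ltW a0) //; exact: Ka.
have : s * dot (k - p) (k - p) <= a ^+ 2 / 2.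
  by apply: le_trans sD; rewrite ler_pM2l.
move: m1 hp; rewrite e; set X := dot k p; set Y := dot p p in pp *.
set Z := dot (k - p) (k - p) => m1 hp hZ.
have : s * (s * Z) <= s * (a ^+ 2 / 2) by rewrite ler_pM2l.
have : 0 <= s * (2 * (X - Y) + a ^+ 2 / 2 + a ^+ 2 / 2) ->
    0 <= 2 * (X - Y) + a ^+ 2 / 2 + a ^+ 2 / 2.
  by rewrite pmulr_rge0.
rewrite !mulrDr; lra.
Qed.

Lemma clarke_convex n (f : 'rV[R]_n -> 'rV[R]_n) x A B (s : R) : 0 <= s -> s <= 1 ->
  clarke_differential f x A -> clarke_differential f x B ->
  clarke_differential f x (s *: A + (1 - s) *: B).
Proof.
move=> s0 s1 hA hB; apply: convex_comb_hull.
exact: convex_comb_mix s0 s1 (convex_hull_comb hA) (convex_hull_comb hB).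
Qed.

(** The convex set of all [v *m A - t *: v] stays away from 0, so some [p] in it pairs with every
    member to at least half of [dot p p]; the mean value inequality is applied in the direction [p].
    Only the radius depends on [x]: the factor depends on [c] and [n] alone. *)
Lemma clarke_local_expansion n (f : 'rV[R]_n -> 'rV[R]_n) (L : R) x (t c : R) :
  (forall x y, `|f x - f y| <= L * `|x - y|) -> 0 <= L -> 0 < c -> (0 < n)%N ->
  (forall A, clarke_differential f x A ->
     forall v : 'rV[R]_n, c * `|v| <= `|v *m A - t *: v|) ->
  exists2 r, 0 < r & forall y z, `|y - x| < r -> `|z - x| < r ->
    c / (4 * n%:R) * `|y - z| <= `|(f y - t *: y) - (f z - t *: z)|.
Proof.
move=> f_lip L0 c0 n0 hc.
have nR : 0 < n%:R :> R by rewrite ltr0n.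
(* Chosen so that moving a Jacobian by [delta] changes the pairing with [p] by at most
   [dot p p / 4], half of what [p] provides. *)
pose delta := c / (4 * n%:R * n%:R).
have delta0 : 0 < delta by rewrite divr_gt0 // !mulr_gt0.
have [r r0 hr] := jacobian_near_limiting f_lip L0 x delta0.
exists r => // y z hy hz.
have [->|yz] := eqVneq y z; first by rewrite [z - z]subrr normr0 mulr0.
pose v := y - z.
have v0 : v != 0 by rewrite subr_eq0.
have nv : 0 < `|v| by rewrite normr_gt0.
have zv : z + v = y by rewrite addrC subrK.
have hzv : `|z + v - x| < r by rewrite zv.
pose K := [set v *m A - t *: v | A in clarke_differential f x].
(* An empty Clarke differential would leave no point of differentiability near [x]; the mean value
   inequality, with its hypothesis vacuous, would then give 1 <= 0. *)
have [K0|Kn0] := pselect (K !=set0); last first.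
  have : 1 <= dot (f (z + v) - f z) 0.
    apply: (mean_value f_lip L0 _ v0 hz hzv) => w A hw /has_jacobianP [dw _].
    have [A' hA' _] := hr w hw dw; exfalso; apply: Kn0.
    by exists (v *m A' - t *: v), A' => //; exact: sub_gen_smallest.
  rewrite /dot big1 => [|i _]; first by rewrite ler10.
  by rewrite [X in _ * X]mxE mulr0.
have [p [A0 hA0 pE] hp] : exists2 p, K p & forall k, K k -> dot p p / 2 <= dot k p.
  apply: (@near_projection _ K (c * `|v|) (n%:R * `|v| * L + `|t| * `|v|)) => //.
  - by rewrite mulr_gt0.
  - move=> _ _ s s0 s1 [A hA <-] [B hB <-].
    exists (s *: A + (1 - s) *: B); first exact: clarke_convex.
    rewrite mulmxDr -!scalemxAr; apply/rowP => i; rewrite !mxE; ring.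
  - by move=> _ [A hA <-]; exact: hc.
  - move=> _ [A hA <-]; apply: le_trans (ler_normB _ _) _; rewrite normrZ lerD2r.
    apply: le_trans (norm_mulmx _ _) _; rewrite ler_wpM2l ?mulr_ge0 //.
    by apply: norm_convex_hull_le hA => B; exact: norm_limiting_jacobian_le.
have np : c * `|v| <= `|p| by rewrite -pE; exact: hc.
have p0 : 0 < `|p| by apply: lt_le_trans np; rewrite mulr_gt0.
have pp : `|p| * `|p| <= dot p p by rewrite -expr2; exact: sqr_norm_le_dot.
have mv : dot p p / 4 + t * dot v p <= dot (f (z + v) - f z) p.
  apply: (mean_value f_lip L0 _ v0 hz hzv) => w A hw /has_jacobianP [dw <-].
  have [A' hA' dA'] := hr w hw dw.
  have h1 : dot p p / 2 <= dot (v *m A' - t *: v) p.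
    by apply: hp; exists A' => //; exact: sub_gen_smallest.
  have -> : v *m 'J f w = (v *m A' - t *: v) + t *: v + v *m ('J f w - A').
    by rewrite subrK mulmxBr addrC subrK.
  rewrite [leRHS]dotDl (dotDl (v *m A' - t *: v)) dotZl.
  have : `|dot (v *m ('J f w - A')) p| <= dot p p / 4.
    apply: le_trans (norm_dot _ _) _.
    apply: (@le_trans _ _ (n%:R * (n%:R * `|v| * delta) * `|p|)).
      apply: ler_wpM2r => //; apply: ler_wpM2l; first exact: ltW.
      apply: le_trans (norm_mulmx _ _) _.
      by apply: ler_wpM2l; [rewrite mulr_ge0 // ltW | apply: ltW].
    have -> : n%:R * (n%:R * `|v| * delta) * `|p| = c * `|v| * `|p| / 4.
      by rewrite /delta; field; rewrite gt_eqF.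
    by rewrite ler_pM2r //; apply: le_trans pp; rewrite ler_pM2r.
  by rewrite ler_norml => /andP[]; lra.
set d := f y - t *: y - _.
have dE : dot (f (z + v) - f z) p - t * dot v p = dot d p.
  rewrite -dotZl -dotBl zv /d /v; congr (dot _ p).
  by apply/rowP => i; rewrite !mxE; ring.
have h1 : dot p p / 4 <= n%:R * `|d| * `|p|.
  by apply: le_trans (norm_dot _ _); apply: le_trans (ler_norm _); rewrite -dE; lra.
have h2 : `|p| / 4 <= n%:R * `|d|.
  by rewrite -(ler_pM2r p0) mulrAC; apply: le_trans h1; rewrite ler_pM2r.
rewrite -(ler_pM2l nR) -/v.
have -> : n%:R * (c / (4 * n%:R) * `|v|) = c * `|v| / 4 by field; rewrite gt_eqF.
by apply: le_trans h2; rewrite ler_pM2r.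
Qed.

End LocalExpansion.

(** * Continuation of Lipschitz inverses *)

Section Continuation.
Variables (R : realType) (n : nat).
Implicit Types (f g : 'rV[R]_n -> 'rV[R]_n).

Lemma half_contraction_fixpoint f :
  (forall x y, `|f x - f y| <= `|x - y| / 2) -> exists x, f x = x.
Proof.
move=> hf; pose u k := iter k f 0; pose c := `|u 1%N - u 0%N|.
have c0 : 0 <= c by exact: normr_ge0.
have uS k : `|u k.+1 - u k| <= c * side R k.
  elim: k => [|k IH]; first by rewrite [side R 0]expr0 mulr1.
  apply: le_trans (hf (u k.+1) (u k)) _.
  by move: IH; rewrite (sideS R k) mulrDr; lra.
have hl i : exists l, forall k, `|u k 0 i - l| <= 2 * c * side R k.
  have [|l [_ hl]] := @geometric_cvg R (fun k => u k 0 i) c; last by exists l.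
  move=> k; apply: le_trans (uS k).
  by have := mx_entry_le_norm (u k.+1 - u k) 0 i; rewrite !mxE.
have [l {}hl] := choice hl.
pose x : 'rV[R]_n := \row_i l i.
have cs k : 0 <= 2 * c * side R k.
  have s0 := ltW (side_gt0 R k).
  by rewrite mulr_ge0 // mulr_ge0.
have ux k : `|u k - x| <= 2 * c * side R k.
  apply: mx_norm_le => [|o i]; first exact: cs.
  by rewrite ord1 !mxE.
exists x; apply/eqP; rewrite -subr_eq0 -normr_le0; apply/ler_addgt0Pr => e e0.
have q0 : 0 < 4 * c + 1 by rewrite ltr_wpDl // mulr_ge0.
have [k hk] := exists_side_le (divr_gt0 e0 q0).
rewrite add0r -(subrKA (u k.+1)); apply: le_trans (ler_normD _ _) _.
have := hf x (u k); rewrite -[f (u k)]/(u k.+1) [`|x - u k|]distrC => h1.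
have := ux k; have := ux k.+1; have := sideS R k; have := side_gt0 R k.+1.
move: hk; rewrite ler_pdivlMr // => hk.
nra.
Qed.

Lemma parametric_fixpoint (F : 'rV[R]_n -> 'rV[R]_n -> 'rV[R]_n) (K : R) :
  (forall y y' x x', `|F y x - F y' x'| <= K * `|y - y'| + `|x - x'| / 2) ->
  exists g, [/\ forall y, F y (g y) = g y, forall y x, F y x = x -> x = g y &
    forall y y', `|g y - g y'| <= 2 * K * `|y - y'|].
Proof.
move=> hF.
have hfix y : exists x, F y x = x.
  apply: half_contraction_fixpoint => x x'.
  by have := hF y y x x'; rewrite subrr normr0 mulr0 add0r.
have [g hg] := choice hfix.
have lip y y' x x' : F y x = x -> F y' x' = x' -> `|x - x'| <= 2 * K * `|y - y'|.
  by move=> e e'; have := hF y y' x x'; rewrite e e'; lra.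
exists g; split => //; last by move=> y y'; exact: lip.
move=> y x hx; apply/eqP; rewrite -subr_eq0 -normr_le0.
by have := lip y y x (g y) hx (hg y); rewrite subrr normr0 mulr0.
Qed.

Definition shifted f (t : R) (x : 'rV[R]_n) : 'rV[R]_n := f x - t *: x.

Definition lipschitz_inverse (h g : 'rV[R]_n -> 'rV[R]_n) (C : R) : Prop :=
  [/\ cancel g h, cancel h g & forall y y', `|g y - g y'| <= C * `|y - y'|].

(** Continuity method on the segment: the a priori constant [C'] only serves to show that the
    supremum of the good parameters is good, and the local bound then moves past it unless it is
    1. *)
Lemma lipschitz_local_global g (C C' : R) : 0 <= C ->
  (forall y y', `|g y - g y'| <= C' * `|y - y'|) ->
  (forall y, exists2 r, 0 < r & forall a b, `|a - y| < r -> `|b - y| < r ->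
     `|g a - g b| <= C * `|a - b|) ->
  forall y y', `|g y - g y'| <= C * `|y - y'|.
Proof.
move=> C0 glip gloc y0 y1; set v := y0 - y1.
pose gam s := y1 + s *: v.
have gamB s s' : gam s - gam s' = (s - s') *: v.
  by rewrite /gam opprD addrACA subrr add0r -scalerBl.
pose E := [set s | [/\ 0 <= s, s <= 1 & `|g (gam s) - g y1| <= C * s * `|v|]].
have gam0 : gam 0 = y1 by rewrite /gam scale0r addr0.
have E0 : E 0 by rewrite /E /= gam0 subrr normr0 mulr0 mul0r; split.
have supE : has_sup E by split; [exists 0 | exists 1 => s []].
set sg := sup E.
have sg0 : 0 <= sg by apply: ub_le_sup => //; exact: supE.2.
have sg1 : sg <= 1 by apply: ge_sup; [exists 0 | move=> s []].
have Esg : `|g (gam sg) - g y1| <= C * sg * `|v|.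
  apply/ler_addgt0Pr => e e0.
  pose q := (`|C'| + 1) * (`|v| + 1).
  have q0 : 0 < q by rewrite mulr_gt0 // ltr_wpDl.
  have [s Es hs] := sup_adherent (divr_gt0 e0 q0) supE.
  have [s0 s1 hgs] := Es.
  have ssg : s <= sg by apply: ub_le_sup => //; exact: supE.2.
  rewrite -(subrKA (g (gam s))); apply: le_trans (ler_normD _ _) _.
  have h1 : `|g (gam sg) - g (gam s)| <= e.
    apply: le_trans (glip _ _) _; rewrite gamB normrZ ger0_norm ?subr_ge0 //.
    have : (sg - s) * q <= e by rewrite -ler_pdivlMr //; rewrite -/sg in hs; lra.
    apply: le_trans; rewrite mulrCA ler_wpM2l ?subr_ge0 // /q.
    by have := ler_norm C'; have := normr_ge0 C'; have := normr_ge0 v; nra.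
  have h2 : C * s * `|v| <= C * sg * `|v| by rewrite ler_wpM2r // ler_wpM2l.
  by rewrite addrC; apply: lerD => //; apply: le_trans hgs h2.
have [r r0 hr] := gloc (gam sg).
have [sg_lt1|] := ltrP sg 1; last first.
  move=> h; have sgE : sg = 1 by apply/eqP; rewrite eq_le sg1.
  have gam1 : gam 1 = y0 by rewrite /gam scale1r /v addrC subrK.
  by move: Esg; rewrite sgE mulr1 gam1.
pose s' := Num.min 1 (sg + r / (2 * (`|v| + 1))).
have v1 : 0 < 2 * (`|v| + 1) by rewrite mulr_gt0 // ltr_wpDl.
have sgs' : sg < s' by rewrite lt_min sg_lt1 ltrDl divr_gt0.
have s'r : (s' - sg) * `|v| < r.
  have : s' - sg <= r / (2 * (`|v| + 1)).
    have : s' <= sg + r / (2 * (`|v| + 1)) by rewrite ge_min lexx orbT.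
    by lra.
  rewrite ler_pdivlMr // => h.
  have : 0 < s' - sg by rewrite subr_gt0.
  by have := normr_ge0 v; nra.
have Es' : E s'.
  split; first by apply: le_trans (ltW sgs').
    by rewrite ge_min lexx.
  rewrite -(subrKA (g (gam sg))); apply: le_trans (ler_normD _ _) _.
  have h1 : `|g (gam s') - g (gam sg)| <= C * ((s' - sg) * `|v|).
    have d : `|gam s' - gam sg| = (s' - sg) * `|v|.
      by rewrite gamB normrZ gtr0_norm ?subr_gt0.
    by rewrite -d; apply: hr; rewrite ?d // subrr normr0.
  apply: le_trans (lerD h1 Esg) _.
  by rewrite le_eqVlt; apply/orP; left; apply/eqP; ring.
have : s' <= sg by apply: ub_le_sup => //; exact: supE.2.
by rewrite leNgt sgs'.
Qed.

(** A perturbation step doubles the Lipschitz constant; this resets it to the [C] dictated by local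
    expansion, whatever [C'] was. *)
Lemma lipschitz_inverse_upgrade h g (C C' : R) : 0 < C ->
  lipschitz_inverse h g C' ->
  (forall x, exists2 r, 0 < r & forall y z, `|y - x| < r -> `|z - x| < r ->
     C^-1 * `|y - z| <= `|h y - h z|) ->
  lipschitz_inverse h g C.
Proof.
move=> C0 [gK hK glip] hloc; split=> //.
apply: (lipschitz_local_global (ltW C0) glip) => y.
have [r r0 hr] := hloc (g y).
have q0 : 0 < `|C'| + 1 by rewrite ltr_wpDl.
exists (r / (`|C'| + 1)); first by rewrite divr_gt0.
have near a : `|a - y| < r / (`|C'| + 1) -> `|g a - g y| < r.
  rewrite ltr_pdivlMr // => ha; apply: le_lt_trans (glip _ _) _; apply: le_lt_trans ha.
  rewrite mulrC ler_wpM2l //; apply: le_trans (ler_norm _) _; by rewrite lerDl.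
move=> a b /near ha /near hb.
by have := hr _ _ ha hb; rewrite !gK -ler_pdivlMl ?invr_gt0 // invrK.
Qed.

(** The equation f_t(x) = y is rewritten as x = g (y + (t - s) x), a contraction in x of ratio
    1/2. *)
Lemma shifted_perturb f g (s t C : R) : 0 < C -> `|t - s| * C <= 2^-1 ->
  lipschitz_inverse (shifted f s) g C ->
  exists g', lipschitz_inverse (shifted f t) g' (2 * C).
Proof.
move=> C0 hst [gK hK glip].
have hF y y' x x' : `|g (y + (t - s) *: x) - g (y' + (t - s) *: x')| <=
    C * `|y - y'| + `|x - x'| / 2.
  apply: le_trans (glip _ _) _; rewrite opprD addrACA -scalerBr.
  apply: le_trans (ler_wpM2l (ltW C0) (ler_normD _ _)) _.
  rewrite mulrDr lerD2l normrZ.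
  by have := ler_wpM2r (normr_ge0 (x - x')) hst; lra.
have [g' [h1 h2 h3]] := parametric_fixpoint hF.
have e x : shifted f s x = shifted f t x + (t - s) *: x.
  by rewrite /shifted scalerBl addrA subrK.
exists g'; split=> // [y|x].
  have := gK (y + (t - s) *: g' y); rewrite h1 e => /eqP.
  by rewrite (can_eq (addrK _)) => /eqP.
by apply/esym/h2; rewrite -e hK.
Qed.

Lemma shifted_large_inverse f (L T : R) : 0 < T -> 2 * L <= T ->
  (forall x y, `|f x - f y| <= L * `|x - y|) ->
  exists g, lipschitz_inverse (shifted f T) g (2 * T^-1).
Proof.
move=> T0 LT f_lip.
have hF y y' x x' : `|T^-1 *: (f x - y) - T^-1 *: (f x' - y')| <=
    T^-1 * `|y - y'| + `|x - x'| / 2.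
  rewrite -scalerBr normrZ gtr0_norm ?invr_gt0 //.
  have -> : f x - y - (f x' - y') = (f x - f x') - (y - y').
    by rewrite opprB [in RHS]opprB addrACA [in RHS]addrACA; congr (_ + _); rewrite addrC.
  rewrite ler_pdivrMl //; apply: le_trans (ler_normB _ _) _.
  rewrite mulrDr mulrA divff ?gt_eqF // mul1r addrC lerD2l.
  apply: le_trans (f_lip _ _) _; have := normr_ge0 (x - x'); nra.
have [g [h1 h2 h3]] := parametric_fixpoint hF.
exists g; split=> // [y|x].
  have := h1 y => /(congr1 (fun z => T *: z)).
  rewrite scalerA divff ?gt_eqF // scale1r /shifted => <-.
  by rewrite subKr.
apply/esym/h2; rewrite /shifted subKr scalerA mulVf ?gt_eqF //; exact: scale1r.
Qed.

End Continuation.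

(** * Bijectivity for positive t and the limit at zero *)

Section Injectivity.
Variables (R : realType) (n : nat) (f : 'rV[R]_n -> 'rV[R]_n) (L : R).
Hypothesis n_gt0 : (0 < n)%N.
Hypothesis f_lip : forall x y, `|f x - f y| <= L * `|x - y|.
Hypothesis L_ge0 : 0 <= L.
Hypothesis f_unit : forall x, maximal_rank (clarke_differential f x).
Hypothesis f_stable : forall x,
  spectrum (clarke_differential f x) `<=` [set z : R[i] | complex.Re z < 0].

(** The resolvent bound is uniform on [t, T], so the step [d] depends on one constant [C], and each
    step ends with an inverse of constant [C] again. Finitely many steps lead from [T], where
    [2 * L <= T] gives a contraction, down to [t]. *)
Lemma shifted_invertible t : 0 < t -> exists C g, lipschitz_inverse (shifted f t) g C.
Proof.
move=> t0; pose T := 2 * L + t + 1.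
have tT : t <= T by rewrite /T; have := L_ge0; lra.
have T0 : 0 < T by apply: lt_le_trans tT.
have [c c0 hc] := resolvent_lower_bound n L T t0.
have nR : 0 < n%:R :> R by rewrite ltr0n.
pose c' := c / (4 * n%:R).
have c'0 : 0 < c' by rewrite divr_gt0 // mulr_gt0.
pose C := c'^-1.
have C0 : 0 < C by rewrite invr_gt0.
have hloc s : t <= s -> s <= T -> forall x, exists2 r, 0 < r &
    forall y z, `|y - x| < r -> `|z - x| < r ->
      C^-1 * `|y - z| <= `|shifted f s y - shifted f s z|.
  move=> ts sT x; rewrite /C invrK.
  apply: (clarke_local_expansion f_lip L_ge0 c0 n_gt0) => A hA v.
  apply: hc => //; last by move=> z hz; apply: (f_stable (x := x)); exists A.
  by apply: norm_convex_hull_le hA => B; exact: norm_limiting_jacobian_le.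
pose d := (2 * C)^-1.
have d0 : 0 < d by rewrite invr_gt0 mulr_gt0.
have main k s : t <= s -> s <= T -> T - k%:R * d <= s ->
    exists g, lipschitz_inverse (shifted f s) g C.
  elim: k s => [|k IH] s ts sT hs.
    have -> : s = T by apply/eqP; rewrite eq_le sT; move: hs; rewrite mul0r subr0.
    have LT : 2 * L <= T by rewrite /T; lra.
    have [g hg] := shifted_large_inverse T0 LT f_lip.
    by exists g; apply: lipschitz_inverse_upgrade C0 hg _; exact: hloc.
  pose s' := Num.min T (s + d).
  have ss' : s <= s' by rewrite le_min sT lerDl ltW.
  have s'T : s' <= T by rewrite ge_min lexx.
  have s's : s' <= s + d by rewrite ge_min lexx orbT.
  have hs' : T - k%:R * d <= s'.
    rewrite le_min; apply/andP; split; first by rewrite gerBl mulr_ge0 // ltW.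
    by move: hs; rewrite -natr1 mulrDl mul1r; lra.
  have [g hg] := IH s' (le_trans ts ss') s'T hs'.
  have dist : `|s - s'| * C <= 2^-1.
    have h : `|s - s'| <= d by rewrite ler_norml; apply/andP; split; lra.
    apply: le_trans (ler_wpM2r (ltW C0) h) _.
    by rewrite /d invfM mulfVK ?gt_eqF.
  have [g' hg'] := shifted_perturb C0 dist hg.
  by exists g'; apply: lipschitz_inverse_upgrade C0 hg' _; exact: hloc.
have [N hN] : exists N : nat, T <= N%:R * d.
  exists (Num.truncn (T / d)).+1.
  have /truncn_itv/andP[_ h] : 0 <= T / d by rewrite divr_ge0 // ltW.
  by rewrite -ler_pdivrMr // ltW.
have [|g hg] := main N t (lexx t) tT; last by exists C, g.
by apply: le_trans (ltW t0); rewrite subr_le0.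
Qed.

(** A priori [g (f x)] might be far from [x], where the expansion at [x] says nothing. The path from
    f_t(x) to f(x) is therefore lifted by [g], starting at [x]: if it went beyond distance [mu], it
    would contain a point at distance exactly [mu], and there expansion contradicts the smallness of
    [t]. *)
Lemma shifted_inverse_near x eps : 0 < eps -> exists2 tau, 0 < tau &
  forall t, 0 < t -> t < tau -> forall C g, lipschitz_inverse (shifted f t) g C ->
    `|g (f x) - x| <= eps.
Proof.
move=> eps0.
have [c c0 hc] := hull_lower_bound (norm_limiting_jacobian_le f_lip L_ge0 (x := x))
  (@limiting_jacobian_closed _ _ f x) (@f_unit x).
have nR : 0 < n%:R :> R by rewrite ltr0n.
pose c' := c / (4 * n%:R).
have c'0 : 0 < c' by rewrite divr_gt0 // mulr_gt0.
have [r r0 hr] : exists2 r, 0 < r & forall y z, `|y - x| < r -> `|z - x| < r ->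
    c' * `|y - z| <= `|(f y - 0 *: y) - (f z - 0 *: z)|.
  apply: (clarke_local_expansion f_lip L_ge0 c0 n_gt0) => A hA v.
  by rewrite scale0r subr0; exact: hc.
pose mu := Num.min eps r / 2.
have mu0 : 0 < mu by rewrite divr_gt0 // lt_min eps0.
have mur : mu < r.
  by have : Num.min eps r <= r; [rewrite ge_min lexx orbT | rewrite /mu; lra].
have mueps : mu <= eps.
  by have : Num.min eps r <= eps; [rewrite ge_min lexx | rewrite /mu; lra].
(* At the point [z] on the sphere, [|f z - f x|] is at most t |x| + t mu; each bound in [tau] keeps
   one of these terms below c' mu / 2. *)
pose tau := Num.min (c' / 2) (c' / 2 * mu / (`|x| + 1)).
have x1 : 0 < `|x| + 1 by rewrite ltr_wpDl.
have c'2 : 0 < c' / 2 by exact: divr_gt0.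
exists tau.
  by rewrite lt_min; apply/andP; split=> //; apply: divr_gt0 => //; exact: mulr_gt0.
move=> t t0; rewrite lt_min (ltr_pdivlMr _ _ x1) => /andP[tc tx] C g [gK hK glip].
apply: le_trans mueps; rewrite leNgt; apply/negP => hlt.
pose y0 := shifted f t x.
pose phi s := `|g (y0 + s *: (t *: x)) - x|.
have phi_lip s s' : `|phi s - phi s'| <= `|C| * `|t *: x| * `|s - s'|.
  apply: le_trans (ler_dist_dist _ _) _; rewrite opprB addrA subrK.
  apply: le_trans (glip _ _) _; rewrite opprD addrACA subrr add0r -scalerBl normrZ.
  rewrite mulrA -[leRHS]mulrA [_ * `|s - s'|]mulrC mulrA ler_wpM2r //.
  by rewrite ler_wpM2r // ler_norm.
have phi_cont : continuous phi.
  move=> s; apply/cvgrPdist_lt => e e0.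
  pose q := `|C| * `|t *: x| + 1.
  have q0 : 0 < q by rewrite ltr_wpDl // mulr_ge0.
  have : \forall s' \near s, `|s - s'| < e / q.
    by apply: nbhsx_ballx; rewrite divr_gt0.
  apply: filterS => s'; rewrite ltr_pdivlMr // => hs'.
  apply: le_lt_trans (phi_lip _ _) _; apply: le_lt_trans hs'.
  by rewrite mulrC ler_wpM2l // lerDl.
have phi0 : phi 0 = 0 by rewrite /phi scale0r addr0 /y0 hK subrr normr0.
have phi1 : phi 1 = `|g (f x) - x| by rewrite /phi scale1r /y0 /shifted subrK.
have [||s] := @IVT R phi 0 1 mu ler01.
- exact: continuous_subspaceT.
- by rewrite phi0 phi1 ge_min le_max (ltW mu0) (ltW hlt) orbT.
rewrite in_itv /= => /andP[s0 s1] phis.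
pose z := g (y0 + s *: (t *: x)).
have hz : `|z - x| = mu by [].
have zr : `|z - x| < r by rewrite hz.
have xr : `|x - x| < r by rewrite subrr normr0.
have := hr z x zr xr; rewrite !scale0r !subr0 hz => h1.
have e : f z - f x = s *: (t *: x) + t *: (z - x).
  have := gK (y0 + s *: (t *: x)); rewrite -/z /y0 /shifted => h.
  have -> : f z = f x - t *: x + s *: (t *: x) + t *: z by rewrite -h subrK.
  by apply/rowP => i; rewrite !mxE; ring.
have h2 : `|f z - f x| <= t * `|x| + t * mu.
  rewrite e; apply: le_trans (ler_normD _ _) _; rewrite !normrZ hz (gtr0_norm t0) (ger0_norm s0).
  rewrite lerD2r ler_piMl // mulr_ge0 // ltW //.
have h3 : t * mu <= c' / 2 * mu by apply: ler_wpM2r; exact: ltW.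
have h4 : t * (`|x| + 1) < c' / 2 * mu by exact: tx.
by move: h1 h2 h3 h4 t0; rewrite mulrDr mulr1; lra.
Qed.

Lemma stable_lipschitz_injective : injective f.
Proof.
move=> x1 x2 fx; apply/eqP; rewrite -subr_eq0 -normr_le0.
apply/ler_addgt0Pr => e e0; rewrite add0r.
have e2 : 0 < e / 2 by rewrite divr_gt0.
have [t1 t10 h1] := shifted_inverse_near x1 e2.
have [t2 t20 h2] := shifted_inverse_near x2 e2.
pose t := Num.min t1 t2 / 2.
have m0 : 0 < Num.min t1 t2 by rewrite lt_min t10.
have t0 : 0 < t by rewrite divr_gt0.
have tt1 : t < t1.
  by have : Num.min t1 t2 <= t1; [rewrite ge_min lexx | rewrite /t; lra].
have tt2 : t < t2.
  by have : Num.min t1 t2 <= t2; [rewrite ge_min lexx orbT | rewrite /t; lra].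
have [C [g hg]] := shifted_invertible t0.
have := h1 t t0 tt1 C g hg; have := h2 t t0 tt2 C g hg; rewrite fx => k2 k1.
rewrite -(subrKA (g (f x2))); apply: le_trans (ler_normD _ _) _.
by rewrite [`|x1 - _|]distrC; lra.
Qed.

End Injectivity.

Theorem corollary4p9 (R : realType) (n : nat) (f : 'rV[R]_n -> 'rV[R]_n)
  (f_lipschitz : lipschitz f)
  (f_maximal_rank : forall x : 'rV[R]_n, maximal_rank (clarke_differential f x))
  (f_spectrum : forall x : 'rV[R]_n,
     spectrum (clarke_differential f x) `<=` [set z : R[i] | complex.Re z < 0]) :
  injective f.
Proof.
case: (posnP n) => [n0|n_gt0].
  move: f f_lipschitz f_maximal_rank f_spectrum; rewrite n0 => f _ _ _ x y _.
  by rewrite [x]thinmx0 [y]thinmx0.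
have [M [_ hM]] := f_lipschitz.
(* The Lipschitz bound is given only for constants strictly above [M], hence the added 1; the
   maximum with 0 provides nonnegativity. *)
pose L := Num.max M 0 + 1.
have ML : M < L.
  by apply: (@le_lt_trans _ _ (Num.max M 0)); rewrite ?le_max ?lexx // ltrDl.
have L0 : 0 <= L by rewrite addr_ge0 // le_max lexx orbT.
apply: (stable_lipschitz_injective n_gt0 (L := L)) => // x y.
by have := hM L ML (x, y); apply.
Qed.
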